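(* Let $X=\mathbb S^1=\mathbb R/\mathbb Z$ with the Borel $\sigma$-field $\mathscr B$ and the normalized Lebesgue measure $m$. Let $\alpha,\beta\in[0,1]$, let $f_1(x)=x+\alpha\pmod1$ and $f_2(x)=x+\beta\pmod 1$, with probabilities $p_1=p_2=\frac12$, and let $\mathcal L_f=\frac12\mathcal L_1+\frac12\mathcal L_2$, where $\mathcal L_i$ is the Perron--Frobenius operator of $f_i$ on $L^1(m)$. The following hold: (1) If $\alpha-\beta$ is irrational, then $\mathcal L_f$ satisfies (C). (2) If $\alpha$ and $\beta$ are irrational numbers such that $\alpha-\beta$ is rational, then $\mathcal L_f$ satisfies (MC) but does not satisfy (AC). (3) If $\alpha$ and $\beta$ are rational numbers, then $\mathcal L_f$ satisfies (WAP) but does not satisfy (MC).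
   Context: The Perron--Frobenius operator $\mathcal L_g$ of a nonsingular map $g$ is defined by $\int_A\mathcal L_g\varphi\,dm=\int_{g^{-1}(A)}\varphi\,dm$ for all $\varphi\in L^1(m)$, $A\in\mathscr B$. $D(m)=\{h\in L^1(m):h\ge0\ m\text{-a.e.},\ \|h\|=1\}$ and $d(\varphi,F)=\inf_{\psi\in F}\|\varphi-\psi\|$ ($L^1(m)$-norm). For a Markov operator $P$ on $L^1(m)$, put $A_n=\frac1n\sum_{i=0}^{n-1}P^i$. (C) (constrictive): there is a compact $F\subset L^1(m)$ with $\lim_{n\to\infty}d(P^nh,F)=0$ for every $h\in D(m)$. (AC) (asymptotically constrictive): for any $\varepsilon>0$ there is $\delta>0$ such that $\limsup_{n\to\infty}\int_AP^n\varphi\,dm<\varepsilon$ for any $\varphi\in D(m)$ and $A\in\mathscr B$ with $m(A)<\delta$. (MC) (mean constrictive): there is a compact $F\subset L^1(m)$ with $\lim_{n\to\infty}d(A_nh,F)=0$ for every $h\in D(m)$. (WAP) (weakly almost periodic): for any $\varphi\in L^1(m)$ the sequence $(P^n\varphi)_{n\ge1}$ is weakly precompact in $L^1(m)$. *)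

(* Defs.v *)
From HB Require Import structures.
From mathcomp Require Import all_boot all_order all_algebra.
From mathcomp Require Import all_classical all_reals all_analysis.
From mathcomp Require Import measurable_realfun.

Set Implicit Arguments.
Unset Strict Implicit.
Unset Printing Implicit Defensive.
Import Order.TTheory GRing.Theory Num.Theory.
Import numFieldNormedType.Exports.

Local Open Scope classical_set_scope.
Local Open Scope ring_scope.

Section L1_space.
Context d (T : measurableType d) (R : realType).
Variable mu : {measure set T -> \bar R}.

(* The library's L^1 space of classes modulo a.e. equality carries no algebraic
   or metric structure; operations and norm are computed on representatives. *)
Definition L1 : Type := LspaceType1 mu.
Definition L1_fun (f : L1) : T -> R := (f : LspaceType1 mu).

Local Notation L1fun := (LfunType mu (@lexx _ _ 1%E)).
Local Notation classes := {mfun_ mu, T >-> measurableTypeR R}.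

Lemma measurable_L1_fun (f : L1) : measurable_fun [set: T] (L1_fun f).
Proof. exact: (@measurable_funPT _ _ _ _ (repr (f : classes))). Qed.

Lemma L1_fun_in (f : L1) : L1_fun f \in Lfun mu 1.
Proof.
rewrite inE; apply/andP; split; rewrite inE /=; first exact: measurable_L1_fun.
exact: (@Lebesgue_finite _ _ _ _ _ _ (f : LspaceType1 mu)).
Qed.

Definition L1_repr (f : L1) : L1fun := Lfun_Sub (lexx 1%E) (L1_fun_in f).

Definition L1_mfun (f : L1fun) : {mfun T >-> measurableTypeR R} :=
  HB.pack_for {mfun T >-> measurableTypeR R} (f : T -> R)
    (@isMeasurableFun.Build _ _ T (measurableTypeR R) f (measurable_funPT f)).

Definition L1_class_mfun (f : L1fun) : classes := (\pi_classes (L1_mfun f))%qT.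

Lemma L1_class_mfunE (f : L1fun) : L1_class_mfun f = f %[ae mu].
Proof.
have /eqmodP/asboolP : (repr (L1_class_mfun f) = L1_mfun f %[mod classes])%qT.
  by rewrite reprK.
exact.
Qed.

Lemma ae_eq_Lnorm1 (f g : T -> R) :
  measurable_fun setT f -> measurable_fun setT g -> f = g %[ae mu] ->
  'N[mu]_1[EFin \o f]%E = 'N[mu]_1[EFin \o g]%E.
Proof.
move=> mf mg fg; rewrite !Lnorm1.
apply: ae_eq_integral => //.
- by apply: (measurableT_comp (@abse_measurable _ setT)); exact/measurable_EFinP.
- by apply: (measurableT_comp (@abse_measurable _ setT)); exact/measurable_EFinP.
- by move: fg; apply: filterS => x /= fgx _; rewrite fgx.
Qed.

Lemma finite_norm_L1_class (f : L1fun) :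
  finite_norm mu 1 (L1_class_mfun f : T -> R).
Proof.
have := LfunP f; rewrite inE => /andP[_]; rewrite inE /= /finite_norm.
rewrite (@ae_eq_Lnorm1 (L1_class_mfun f) f) //.
- exact: (@measurable_funPT _ _ _ _ (repr (L1_class_mfun f))).
- exact: L1_class_mfunE.
Qed.

Definition L1_class (f : L1fun) : L1 :=
  HB.pack_for (LspaceType1 mu) (L1_class_mfun f)
    (@isFinLebesgue.Build _ _ _ mu 1%E (lexx 1%E) (L1_class_mfun f)
       (finite_norm_L1_class f)).

Lemma L1_classE (f : L1fun) : L1_fun (L1_class f) = f %[ae mu].
Proof. exact: L1_class_mfunE. Qed.

Lemma L1_eq (f g : L1) : L1_fun f = L1_fun g %[ae mu] -> f = g.
Proof.
case: f g => [f [[cf]]] [g [[cg]]]; rewrite /L1_fun /= => fg.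
have E : f = g.
  have /eqmodP : ae_eq_op mu (repr f) (repr g) by apply/asboolP.
  by rewrite !reprK.
case: _ / E in cg fg *.
by rewrite (Prop_irrelevance cf cg).
Qed.

Lemma L1_class_eq (f g : L1fun) :
  f = g %[ae mu] -> L1_class f = L1_class g.
Proof.
move=> fg; apply: L1_eq.
move: (L1_classE g); apply: filter_app.
move: (L1_classE f); apply: filter_app.
move: (fg); apply: filter_app.
apply: aeW => x /=.
by move=> h h1 h2 _; rewrite h1 // h2 // h.
Qed.

Lemma L1_reprK (f : L1) : L1_class (L1_repr f) = f.
Proof. exact/L1_eq/L1_classE. Qed.

HB.instance Definition _ := gen_eqMixin L1.
HB.instance Definition _ := gen_choiceMixin L1.

Let L1_zero := L1_class 0.
Let L1_opp f := L1_class (- L1_repr f).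
Let L1_add f g := L1_class (L1_repr f + L1_repr g).
Let L1_scale (a : R) f := L1_class (a *: L1_repr f).

Let L1_zeroE : L1_fun L1_zero = cst 0 %[ae mu].
Proof. exact: L1_classE. Qed.

Let L1_oppE f : L1_fun (L1_opp f) = \- (L1_fun f) %[ae mu].
Proof. exact: L1_classE. Qed.

Let L1_addE f g : L1_fun (L1_add f g) = L1_fun f \+ L1_fun g %[ae mu].
Proof. exact: L1_classE. Qed.

Let L1_scaleE a f : L1_fun (L1_scale a f) = a \*: L1_fun f %[ae mu].
Proof. exact: L1_classE. Qed.

Let L1_addA : associative L1_add.
Proof.
move=> f g h; apply: L1_eq.
move: (L1_addE f g); apply: filter_app.
move: (L1_addE (L1_add f g) h); apply: filter_app.
move: (L1_addE g h); apply: filter_app.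
move: (L1_addE f (L1_add g h)); apply: filter_app.
apply: aeW => x /=.
by move=> a b c e _; rewrite a // b // c // e //= addrA.
Qed.

Let L1_addC : commutative L1_add.
Proof. by move=> f g; rewrite /L1_add addrC. Qed.

Let L1_add0 : left_id L1_zero L1_add.
Proof.
move=> f; apply: L1_eq.
move: (L1_zeroE); apply: filter_app.
move: (L1_addE L1_zero f); apply: filter_app.
apply: aeW => x /=.
by move=> a b _; rewrite a // b //= add0r.
Qed.

Let L1_addN : left_inverse L1_zero L1_opp L1_add.
Proof.
move=> f; apply: L1_eq.
move: (L1_oppE f); apply: filter_app.
move: (L1_zeroE); apply: filter_app.
move: (L1_addE (L1_opp f) f); apply: filter_app.
apply: aeW => x /=.
by move=> a b c _; rewrite a // b // c //= addNr.
Qed.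

HB.instance Definition _ := GRing.isZmodule.Build L1
  L1_addA L1_addC L1_add0 L1_addN.

Let L1_scaleA a b f : L1_scale a (L1_scale b f) = L1_scale (a * b) f.
Proof.
apply: L1_eq; move: (L1_scaleE (a * b) f); apply: filter_app.
move: (L1_scaleE b f); apply: filter_app.
move: (L1_scaleE a (L1_scale b f)); apply: filter_app.
apply: aeW => x /=.
by move=> h1 h2 h3 _; rewrite h1 // h2 // h3 //= scalerA.
Qed.

Let L1_scale1 : left_id 1 L1_scale.
Proof. by move=> f; rewrite /L1_scale scale1r L1_reprK. Qed.

Let L1_scaleDr : right_distributive L1_scale +%R.
Proof.
move=> a f g; apply: L1_eq.
move: (L1_scaleE a g); apply: filter_app.
move: (L1_scaleE a f); apply: filter_app.
move: (L1_addE (L1_scale a f) (L1_scale a g)); apply: filter_app.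
move: (L1_addE f g); apply: filter_app.
move: (L1_scaleE a (f + g)); apply: filter_app.
apply: aeW => x /=.
move=> h1 h2 h3 h4 h5 _.
by rewrite h1 // h2 // h3 // h4 // h5 //= scalerDr.
Qed.

Let L1_scaleDl f : {morph L1_scale^~ f : a b / a + b}.
Proof.
move=> a b; apply: L1_eq.
move: (L1_addE (L1_scale a f) (L1_scale b f)); apply: filter_app.
move: (L1_scaleE b f); apply: filter_app.
move: (L1_scaleE a f); apply: filter_app.
move: (L1_scaleE (a + b) f); apply: filter_app.
apply: aeW => x /=.
move=> h1 h2 h3 h4 _.
by rewrite h1 // h4 // h2 // h3 //= scalerDl.
Qed.

HB.instance Definition _ := GRing.Zmodule_isLmodule.Build R L1
  L1_scaleA L1_scale1 L1_scaleDr L1_scaleDl.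

Definition L1_norm (f : L1) : R := fine 'N[mu]_1[EFin \o L1_fun f]%E.

Let L1_norm_class (f : L1fun) :
  L1_norm (L1_class f) = fine 'N[mu]_1[EFin \o f]%E.
Proof.
rewrite /L1_norm (@ae_eq_Lnorm1 (L1_class f) f) //.
- exact: measurable_L1_fun.
- exact: L1_classE.
Qed.

Let ler_L1_normD f g : L1_norm (f + g) <= L1_norm f + L1_norm g.
Proof. by rewrite L1_norm_class; exact: ler_LnormD. Qed.

Let L1_normZ a f : L1_norm (a *: f) = `|a| * L1_norm f.
Proof.
rewrite L1_norm_class.
rewrite [X in fine X](LnormZ (L1_repr f) a) fineM //.
by rewrite -finite_norm_fine.
Qed.

Let L1_norm_eq0 f : L1_norm f = 0 -> f = 0.
Proof.
move=> f0; apply: L1_eq.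
move: L1_zeroE; apply: filter_app.
move: (@fine_Lnormr_eq0 _ _ _ _ _ _ (L1_repr f) f0); apply: filter_app.
by apply: aeW => x /= f0x -> // _; rewrite f0x.
Qed.

HB.instance Definition _ := Lmodule_isNormed.Build R L1
  ler_L1_normD L1_normZ L1_norm_eq0.

Lemma L1_normE (f : L1) : `|f| = \int[mu]_x `|L1_fun f x|.
Proof. by rewrite {1}/Num.norm /= /L1_norm Lnorm1 /Rintegral. Qed.

End L1_space.
Coercion L1_fun : L1 >-> Funclass.

(* V with the coarsest topology making the norm-continuous linear functionals
   continuous *)
Definition weakly (R : realType) (V : normedModType R) : Type :=
  sup_topology (fun f : {f : {linear V -> R^o} | continuous f} =>
    Topological.class (initial_topology (sval f))).
HB.instance Definition _ (R : realType) (V : normedModType R) :=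
  Topological.on (weakly V).

Section perron_frobenius.
Context d (T : measurableType d) (R : realType).
Variable mu : {measure set T -> \bar R}.

Definition perron_frobenius_spec (g : T -> T) (phi psi : L1 mu) : Prop :=
  forall A, measurable A ->
    \int[mu]_(x in A) psi x = \int[mu]_(x in g @^-1` A) phi x.

Definition perron_frobenius (g : T -> T) (phi : L1 mu) : L1 mu :=
  get (perron_frobenius_spec g phi).

Lemma perron_frobenius_spec_uniq g phi psi psi' :
  perron_frobenius_spec g phi psi -> perron_frobenius_spec g phi psi' ->
  psi = psi'.
Proof.
move=> h h'; apply: L1_eq.
have int (f : L1 mu) : mu.-integrable setT (EFin \o f).
  exact/Lfun1_integrable/L1_fun_in.
have : ae_eq mu setT (EFin \o psi) (EFin \o psi').
  apply: integral_ae_eq => //; first exact: (measurable_int mu).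
  move=> E _ mE; have := h E mE; rewrite -h' // /Rintegral => eqE.
  rewrite -[LHS]fineK; last first.
    by apply: integrable_fin_num => //; exact: integrableS (int _).
  rewrite -[RHS]fineK ?eqE //.
  by apply: integrable_fin_num => //; exact: integrableS (int _).
by apply: filterS => x /= e /e [].
Qed.

End perron_frobenius.

(* For nonsingular g the specification is met, by Radon-Nikodym, so the choice
   made in [perron_frobenius] is never the default one. *)
Section perron_frobenius_exists.
Context d (T : measurableType d) (R : realType) (mu : probability T R).

Lemma perron_frobeniusP (g : T -> T) (phi : L1 mu) :
  measurable_fun setT g ->
  (forall A, measurable A -> mu A = 0%E -> mu (g @^-1` A) = 0%E) ->
  perron_frobenius_spec g phi (perron_frobenius g phi).
Proof.
move=> mg ns.
suff [psi psiP] : exists psi, perron_frobenius_spec g phi psi.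
  exact: (getI psiP).
have intphi : mu.-integrable setT (EFin \o phi).
  exact/Lfun1_integrable/L1_fun_in.
have mpre A : measurable A -> measurable (g @^-1` A).
  by move=> mA; rewrite -(setTI (g @^-1` A)); exact: mg.
have [f [ffin intf fE]] : exists f : T -> \bar R,
    [/\ forall x, f x \is a fin_num, mu.-integrable setT f &
     forall A, measurable A ->
       (\int[mu]_(x in g @^-1` A) (phi x)%:E)%E = (\int[mu]_(x in A) f x)%E].
  pose nu0 (A : set T) := (\int[mu]_(x in g @^-1` A) (phi x)%:E)%E.
  have nu00 : nu0 set0 = 0%E by rewrite /nu0 preimage_set0 integral_set0.
  have nu0fin A : measurable A -> nu0 A \is a fin_num.
    move=> /mpre mA; apply: integrable_fin_num => //.
    exact: (integrableS _ _ _ intphi).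
  have nu0add : semi_sigma_additive nu0.
    rewrite -[nu0]/(pushforward (induced_charge intphi) g).
    by apply: charge_semi_sigma_additive; exact: mg.
  pose nu := HB.pack_for ({charge set T -> \bar R})%R nu0
    (isCharge.Build _ _ _ nu0 nu00 nu0fin nu0add).
  have numu : nu `<< mu.
    apply/null_content_dominatesP => A mA muA.
    apply: null_set_integral; [exact: mpre| |exact: ns].
    by apply: measurable_funTS; exact: (measurable_int mu).
  exists (Radon_Nikodym nu mu); split.
  - by move=> x; exact: Radon_Nikodym_fin_num.
  - exact: Radon_Nikodym_integrable.
  - by move=> A mA; rewrite -Radon_Nikodym_integral.
have fineL : (fine \o f) \in Lfun mu 1.
  apply/Lfun1_integrable; apply: eq_integrable intf => // x _ /=.
  by rewrite fineK.
exists (L1_class (Lfun_Sub (lexx 1%E) fineL)) => A mA.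
rewrite /Rintegral fE //; congr fine.
apply: ae_eq_integral => //.
- by apply: measurable_funTS; apply/measurable_EFinP; exact: measurable_L1_fun.
- by apply: measurable_funTS; exact: (measurable_int mu).
- move: (L1_classE (Lfun_Sub (lexx 1%E) fineL)); apply: filterS => x /= e _.
  by rewrite e //= fineK.
Qed.

End perron_frobenius_exists.

Section operators.
Context d (T : measurableType d) (R : realType).
Variable mu : {measure set T -> \bar R}.

Definition density (h : L1 mu) : Prop :=
  (\forall x \ae mu, 0 <= h x) /\ `|h| = 1.

(* +oo when F is empty *)
Definition dist_to (phi : L1 mu) (F : set (L1 mu)) : \bar R :=
  ereal_inf [set `|phi - psi|%:E | psi in F].

Definition cesaro (P : L1 mu -> L1 mu) (n : nat) (phi : L1 mu) : L1 mu :=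
  n%:R^-1 *: \sum_(i < n) iter i P phi.

Definition constrictive (P : L1 mu -> L1 mu) : Prop :=
  exists F : set (L1 mu), compact F /\
    forall h, density h -> dist_to (iter n P h) F @[n --> \oo] --> 0%E.

Definition asymptotically_constrictive (P : L1 mu -> L1 mu) : Prop :=
  forall e : R, 0 < e -> exists2 delta : R, 0 < delta &
    forall (phi : L1 mu) (A : set T), density phi -> measurable A ->
      (mu A < delta%:E)%E ->
      (limn_esup (fun n => (\int[mu]_(x in A) iter n P phi x)%:E) < e%:E)%E.

Definition mean_constrictive (P : L1 mu -> L1 mu) : Prop :=
  exists F : set (L1 mu), compact F /\
    forall h, density h -> dist_to (cesaro P n h) F @[n --> \oo] --> 0%E.

Definition weakly_almost_periodic (P : L1 mu -> L1 mu) : Prop :=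
  forall phi : L1 mu,
    precompact ([set iter n P phi | n in [set n | (1 <= n)%N]]
      : set (weakly (L1 mu))).

End operators.

Section circle.
Local Open Scope quotient_scope.
Variable R : realType.

Definition eq_mod1 (x y : R) : bool := x - y \is a Num.int.

Lemma eq_mod1_refl : reflexive eq_mod1.
Proof. by move=> x; rewrite /eq_mod1 subrr rpred0. Qed.

Lemma eq_mod1_sym : symmetric eq_mod1.
Proof. by move=> x y; rewrite /eq_mod1 -opprB rpredN. Qed.

Lemma eq_mod1_trans : transitive eq_mod1.
Proof.
by move=> y x z xy yz; rewrite /eq_mod1 -(subrKA y x) rpredD.
Qed.

Canonical eq_mod1_equiv :=
  EquivRel eq_mod1 eq_mod1_refl eq_mod1_sym eq_mod1_trans.

(* R/Z with the quotient topology *)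
Definition RmodZ : Type := quotient_topology {eq_quot eq_mod1}.
HB.instance Definition _ := PointedTopological.on RmodZ.
HB.instance Definition _ := Quotient.on RmodZ.

(* R/Z with its Borel sigma-algebra *)
Definition circle : Type := g_sigma_algebraType (@open RmodZ).
HB.instance Definition _ := Measurable.on circle.

Definition to_circle (x : R) : circle := \pi_RmodZ x.

Lemma measurable_to_circle : measurable_fun [set: measurableTypeR R] to_circle.
Proof.
apply: (@measurability _ _ _ _ setT to_circle (@open RmodZ)); first by [].
move=> _ [B oB <-]; rewrite setTI.
apply: measurable_realfun.open_measurable.
by move/continuousP: (@pi_continuous R {eq_quot eq_mod1}); exact.
Qed.

HB.instance Definition _ :=
  @isMeasurableFun.Build _ _ _ _ to_circle measurable_to_circle.

Definition circle_measure : set circle -> \bar R :=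
  pushforward (mrestr (@lebesgue_measure R) (measurable_itv `[0%R, 1%R[))
    to_circle.

Let circle_measure0 : circle_measure set0 = 0%E.
Proof. by apply: measure0; exact: measurable_to_circle. Qed.

Let circle_measure_ge0 A : (0 <= circle_measure A)%E.
Proof. by apply: measure_ge0; exact: measurable_to_circle. Qed.

Let circle_measure_sigma_additive : semi_sigma_additive circle_measure.
Proof. by apply: measure_semi_sigma_additive; exact: measurable_to_circle. Qed.

HB.instance Definition _ := isMeasure.Build _ _ _ circle_measure
  circle_measure0 circle_measure_ge0 circle_measure_sigma_additive.

Lemma circle_measure_setT : circle_measure setT = 1%:E.
Proof.
rewrite /circle_measure /pushforward preimage_setT /mrestr setTI.
by rewrite lebesgue_measure_itv/= lte01 oppr0 adde0.
Qed.

HB.instance Definition _ :=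
  Measure_isProbability.Build _ _ _ circle_measure circle_measure_setT.

Definition rotation (a : R) (x : circle) : circle :=
  to_circle (repr (x : RmodZ) + a).

Lemma to_circleP (x y : R) :
  reflect (to_circle x = to_circle y) (x - y \is a Num.int).
Proof. exact: (@eqmodP _ eq_mod1_equiv x y). Qed.

Lemma to_circleK (x : circle) : to_circle (repr (x : RmodZ)) = x.
Proof. exact: (@reprK _ RmodZ x). Qed.

Lemma rotationE (a x : R) : rotation a (to_circle x) = to_circle (x + a).
Proof.
apply/to_circleP; rewrite [x + a]addrC addrKA.
by apply/to_circleP; rewrite to_circleK.
Qed.

End circle.

Arguments circle_measure : clear implicits.

(* Main.v *)
From HB Require Import structures.
Require Import Defs.
From mathcomp Require Import all_boot all_order all_algebra.
From mathcomp Require Import all_classical all_reals all_analysis.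
From mathcomp Require Import measurable_realfun.
From mathcomp Require Import ring lra.

(** Write T_t for the action of the rotation by t on L^1 of the circle. Rotations
    commute, so L_f = T_alpha S, where S is the average of the identity and of
    U = T_(beta - alpha), and L_f^n h has the same norm as S^n h. Two facts drive
    the convergence statements.

    For every linear contraction U, S^n (f - U f) tends to 0
    ([norm_iter_half_sum]): the coefficients of S^n (f - U f) on the powers of U
    are differences of consecutive binomial weights 2^-n C(n, k), and their total
    variation is of order n^(-1/2).

    A closed subspace of L^1 which contains all f - T_theta f, for one irrational
    theta, contains f - (mean of f) for every f ([mean_ergodic]). Indeed it
    contains a - T_t a for every arc a and every t, since the multiples of theta
    are dense modulo 1; the q rotates of an arc of length 1/q add up to 1, so it
    contains a - (mean of a) for these arcs; their combinations are dense.

    If alpha - beta is irrational, the closed subspace of the f with L_f^n f -> 0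
    contains all f - U f, hence L_f^n h -> 1 for every density h, and the
    singleton of 1 is the required compact set.

    If alpha - beta is a rational p/q, then U^q = 1. Let E be the average of the
    powers of U. Then L_f^n (f - E f) -> 0, whereas L_f acts as T_alpha on the
    range of E. So the closed subspace of the f whose Cesaro means vanish
    contains all f - T_alpha f, and for irrational alpha the Cesaro means of
    densities tend to 1. The iterates themselves do not spread out: a density
    carried by q short arcs and invariant under U ([comb]) is merely rotated, and
    it comes back infinitely often into a slightly larger set of small measure.

    If both angles are multiples of 1/q, then L_f^n f stays in the convex hull of
    the q rotates of f by multiples of 1/q, which lies in a norm compact set. The
    combs with spacing 1/q are now fixed by L_f; thinner and thinner ones stay at
    distance at least 1/2 from each other, so that no compact set attracts all of
    them. *)

Set Implicit Arguments.
Unset Strict Implicit.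
Unset Printing Implicit Defensive.
Import Order.TTheory GRing.Theory Num.Theory.
Import numFieldNormedType.Exports.

Local Open Scope classical_set_scope.
Local Open Scope ring_scope.

(** * Integrals on classes of integrable functions *)

Section L1_theory.
Context d (T : measurableType d) (R : realType) (mu : {measure set T -> \bar R}).
Local Notation L1 := (L1 mu).

Lemma integrable_L1 (f : L1) : mu.-integrable setT (EFin \o f).
Proof. exact/Lfun1_integrable/L1_fun_in. Qed.

Lemma integrableS_L1 (A : set T) (f : L1) :
  measurable A -> mu.-integrable A (EFin \o f).
Proof. by move=> mA; apply: integrableS (integrable_L1 f). Qed.

Lemma L1_addE (f g : L1) : \forall x \ae mu, (f + g : L1) x = f x + g x.
Proof. by apply: filterS (L1_classE (L1_repr f + L1_repr g)) => x; exact. Qed.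

Lemma L1_scaleE a (f : L1) : \forall x \ae mu, (a *: f : L1) x = a * f x.
Proof. by apply: filterS (L1_classE (a *: L1_repr f)) => x; exact. Qed.

Lemma L1_ae_eq (f g : L1) : (\forall x \ae mu, f x = g x) -> f = g.
Proof. by move=> fg; apply: L1_eq; apply: filterS fg. Qed.

(** Total, so that terms carry no integrability proof: a function which is not
    integrable is sent to 0. *)
Definition L1_of (F : T -> R) : L1 :=
  if pselect (F \in Lfun mu 1) is left h then L1_class (Lfun_Sub (lexx 1%E) h)
  else 0.

Lemma L1_ofE F : mu.-integrable setT (EFin \o F) ->
  \forall x \ae mu, L1_of F x = F x.
Proof.
move=> /Lfun1_integrable h; rewrite /L1_of; case: pselect => // h'.
by apply: filterS (L1_classE (Lfun_Sub (lexx 1%E) h')) => x; exact.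
Qed.

Definition set_int (A : set T) (f : L1) : R := \int[mu]_(x in A) f x.

Lemma ae_eq_Rintegral (A : set T) (f g : T -> R) : measurable A ->
  measurable_fun A f -> measurable_fun A g ->
  (\forall x \ae mu, f x = g x) ->
  \int[mu]_(x in A) f x = \int[mu]_(x in A) g x.
Proof.
move=> mA mf mg fg; congr fine; apply: ae_eq_integral => //.
- exact/measurable_EFinP.
- exact/measurable_EFinP.
- by apply: filterS fg => x -> _.
Qed.

Lemma measurable_L1 A (f : L1) : measurable_fun A f.
Proof. by apply: measurable_funTS; exact: measurable_L1_fun. Qed.
Hint Resolve measurable_L1 : core.

Lemma set_intD A f g : measurable A ->
  set_int A (f + g) = set_int A f + set_int A g.
Proof.
move=> mA; rewrite /set_int -RintegralD//; try exact: integrableS_L1.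
apply: ae_eq_Rintegral => //; last exact: L1_addE.
exact: measurable_funD.
Qed.

Lemma set_intZ A a f : measurable A ->
  set_int A (a *: f) = a * set_int A f.
Proof.
move=> mA; rewrite /set_int -RintegralZl//; try exact: integrableS_L1.
apply: ae_eq_Rintegral => //; last exact: L1_scaleE.
exact: measurable_funM.
Qed.

Lemma set_intN A f : measurable A -> set_int A (- f) = - set_int A f.
Proof. by move=> mA; rewrite -scaleN1r set_intZ// mulN1r. Qed.

Lemma set_intB A f g : measurable A ->
  set_int A (f - g) = set_int A f - set_int A g.
Proof. by move=> mA; rewrite set_intD// set_intN. Qed.

Lemma set_int0 A : measurable A -> set_int A 0 = 0.
Proof. by move=> mA; rewrite -(scale0r 0) set_intZ// mul0r. Qed.

Lemma set_int_sum A (I : Type) (s : seq I) (f : I -> L1) : measurable A ->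
  set_int A (\sum_(i <- s) f i) = \sum_(i <- s) set_int A (f i).
Proof.
move=> mA; elim/big_rec2: _ => [|i x y _ <-]; first exact: set_int0.
exact: set_intD.
Qed.

Lemma le_norm_set_int A (f : L1) : measurable A -> `|set_int A f| <= `|f|.
Proof.
move=> mA; rewrite L1_normE /set_int.
apply: le_trans (le_normr_Rintegral mA (integrableS_L1 f mA)) _.
apply: fine_le.
- apply: integrable_fin_num => //.
  exact/(integrable_norm (f := f))/integrableS_L1.
- apply: integrable_fin_num => //.
  exact/(integrable_norm (f := f))/integrable_L1.
- apply: ge0_subset_integral => //=.
  by apply/measurable_EFinP; apply: measurableT_comp.
Qed.

Lemma L1_set_int_inj f g :
  (forall A, measurable A -> set_int A f = set_int A g) -> f = g.
Proof.
by move=> h; apply: (@perron_frobenius_spec_uniq _ _ _ mu idfun g) => A mA //;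
  exact: h.
Qed.

Lemma ge0_norm_L1 (f : L1) : (\forall x \ae mu, 0 <= f x) -> `|f| = set_int setT f.
Proof.
move=> f0; rewrite L1_normE; apply: ae_eq_Rintegral => //.
  by apply: measurableT_comp.
by apply: filterS f0 => x /ger0_norm.
Qed.

Lemma set_int_L1_of A F : measurable A -> mu.-integrable setT (EFin \o F) ->
  set_int A (L1_of F) = \int[mu]_(x in A) F x.
Proof.
move=> mA iF; apply: ae_eq_Rintegral => //; last exact: L1_ofE.
by apply: measurable_funTS; move/integrableP: iF => [/measurable_EFinP].
Qed.

Lemma norm_L1_ofB (f : L1) F : mu.-integrable setT (EFin \o F) ->
  `|f - L1_of F| = \int[mu]_x `|f x - F x|.
Proof.
move=> iF; rewrite L1_normE; apply: ae_eq_Rintegral => //.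
- by apply: measurableT_comp.
- apply: measurableT_comp => //; apply: measurable_funB => //.
  by move/integrableP: iF => [/measurable_EFinP].
- have := L1_ofE iF; have := L1_addE f (- L1_of F).
  have := L1_scaleE (-1) (L1_of F); rewrite scaleN1r.
  apply: filterS3 => x -> -> ->.
  by rewrite mulN1r.
Qed.

Definition L1_one : L1 := L1_of (cst 1).

Definition L1_mean f : L1 := set_int setT f *: L1_one.

Lemma L1_mean_is_linear : linear L1_mean.
Proof.
by move=> a f g; rewrite /L1_mean set_intD// set_intZ// scalerDl scalerA.
Qed.
HB.instance Definition _ :=
  GRing.isLinear.Build R L1 L1 _ L1_mean L1_mean_is_linear.

Hypothesis mu1 : mu setT = 1%E.

Lemma integrable_bounded (F : T -> R) (M : R) : measurable_fun setT F ->
  (forall x, `|F x| <= M) -> mu.-integrable setT (EFin \o F).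
Proof.
move=> mF FM; apply: measurable_bounded_integrable => //.
  by rewrite mu1 ltry.
by exists M; split; rewrite ?num_real// => y My x _; apply: le_trans (FM x) (ltW My).
Qed.

Lemma integrable_one : mu.-integrable setT (EFin \o cst (1 : R)).
Proof. by apply: (integrable_bounded (M := 1)) => // x; rewrite normr1. Qed.

Lemma set_int_one : set_int setT L1_one = 1.
Proof.
rewrite set_int_L1_of//; last exact: integrable_one.
by rewrite Rintegral_cst// mul1r mu1.
Qed.

Lemma norm_L1_one : `|L1_one| = 1.
Proof.
rewrite ge0_norm_L1 ?set_int_one//.
by apply: filterS (L1_ofE integrable_one) => x ->.
Qed.

Lemma norm_L1_mean (f : L1) : `|L1_mean f| <= `|f|.
Proof. by rewrite normrZ norm_L1_one mulr1 le_norm_set_int. Qed.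

End L1_theory.

(** * The circle, its invariant measure and its arcs *)

Section circle_geometry.
Context (R : realType).
Local Notation m := (circle_measure R).
Implicit Types (x : circle R) (s t c y : R).

Lemma measurable_translation t : measurable_fun [set: measurableTypeR R]
  ((fun y => y + t) : measurableTypeR R -> measurableTypeR R).
Proof. exact: measurable_funD. Qed.

Lemma lebesgue_measure_translation t (A : set (measurableTypeR R)) :
  measurable A -> lebesgue_measure ((fun y => y + t) @^-1` A) = lebesgue_measure A.
Proof.
move=> mA.
have mt := measurable_translation t.
rewrite -[LHS]/(pushforward lebesgue_measure
  ((fun y => y + t) : measurableTypeR R -> measurableTypeR R) A).
apply/esym/lebesgue_measure_unique => //= _ [[a b]] _ <-.
rewrite /pushforward.
have -> : (fun y => y + t) @^-1` [set` `]a, b]] = [set` `]a - t, b - t]].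
  by apply/seteqP; split => y /=; rewrite !in_itv/= ltrBlDr lerBrDr.
rewrite !lebesgue_measure_itv/= !lte_fin ltrD2r; case: ifP => // _.
by rewrite -!EFinB; congr EFin; ring.
Qed.

Lemma to_circle_int (n : int) y : to_circle (y + n%:~R) = to_circle y.
Proof. by apply/to_circleP; rewrite addrAC subrr add0r. Qed.

Lemma frac01 y : 0 <= y - (Num.floor y)%:~R < 1.
Proof.
by rewrite subr_ge0 floor_le/= ltrBlDl -[X in _ + X](mulr1z 1) -intrD floorD1_gt.
Qed.

Lemma circleP x : exists2 y, 0 <= y < 1 & x = to_circle y.
Proof.
pose y := repr (x : RmodZ R).
exists (y - (Num.floor y)%:~R); first exact: frac01.
by rewrite -intrN to_circle_int to_circleK.
Qed.

Lemma rotation_int (n : int) : rotation n%:~R = id :> (circle R -> circle R).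
Proof.
apply/funext => x; have [y _ ->] := circleP x.
by rewrite rotationE to_circle_int.
Qed.

Lemma rotationD s t x : rotation s (rotation t x) = rotation (t + s) x.
Proof. by have [y _ ->] := circleP x; rewrite !rotationE addrA. Qed.

Lemma measurable_circle (A : set (circle R)) :
  open (@to_circle R @^-1` A : set R) -> measurable A.
Proof. by move=> oA; apply: sub_sigma_algebra. Qed.

Lemma measurable_rotation t : measurable_fun setT (@rotation R t).
Proof.
apply: (@measurability _ _ _ _ setT (@rotation R t) (@open (RmodZ R))) => //.
move=> _ [B oB <-]; rewrite setTI; apply: measurable_circle.
have -> : @to_circle R @^-1` (@rotation R t @^-1` B) =
    (fun y : R => y + t) @^-1` (@to_circle R @^-1` B).
  by apply/seteqP; split => y /=; rewrite rotationE.
apply: open_comp => // y _.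
by apply: cvgD; [exact: cvg_id|exact: cvg_cst].
Qed.

Lemma measurable_preimage_rotation t (A : set (circle R)) :
  measurable A -> measurable (@rotation R t @^-1` A).
Proof. by move=> mA; rewrite -[X in measurable X]setTI; exact: measurable_rotation. Qed.

Lemma measurable_preimage_to_circle (A : set (circle R)) :
  measurable A -> measurable (@to_circle R @^-1` A : set (measurableTypeR R)).
Proof. by move=> mA; rewrite -[X in measurable X]setTI; exact: measurable_to_circle. Qed.

(** On the line, rotating by [t] replaces the period [0, 1) by [t, 1 + t), whose
    part beyond 1 is the translate by 1 of the missing part [0, t). *)
Lemma circle_measure_rotation t (A : set (circle R)) : measurable A ->
  m (@rotation R t @^-1` A) = m A.
Proof.
move=> mA.
wlog /andP[t0 t1] : t / 0 <= t < 1.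
  have [y y01 /to_circleP ty] := circleP (to_circle t).
  move=> /(_ _ y01) <-; suff -> : @rotation R t = rotation y by [].
  apply/funext => x; have [z _ ->] := circleP x; rewrite !rotationE.
  by apply/to_circleP; rewrite addrAC opprD addrA addrN add0r addrC.
rewrite /circle_measure /pushforward /mrestr.
set B := @to_circle R @^-1` A.
have mB : measurable (B : set (measurableTypeR R)) by exact: measurable_preimage_to_circle.
have BZ y (n : int) : B (y + n%:~R) = B y by rewrite /B /= to_circle_int.
have -> : @to_circle R @^-1` (@rotation R t @^-1` A) `&` [set` `[0, 1[] =
   (fun y => y + t) @^-1` (B `&` [set` `[t, 1 + t[]).
  apply/seteqP; split => y /=; rewrite rotationE !in_itv/=.
    by move=> [? /andP[? ?]]; split => //; apply/andP; split; lra.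
  by move=> [? /andP[? ?]]; split => //; apply/andP; split; lra.
rewrite lebesgue_measure_translation; last exact: measurableI.
have -> : B `&` [set` `[t, 1 + t[] = (B `&` [set` `[t, 1[]) `|`
    ((fun y => y + -1) @^-1` (B `&` [set` `[0, t[])).
  apply/seteqP; split => y /=; rewrite !in_itv/=.
    move=> [By /andP[ty y1]]; have [y1'|y1'] := ltP y 1.
      by left; rewrite ty.
    by right; rewrite -[-1]/((-1)%:~R) BZ; split => //; apply/andP; split; lra.
  move=> [[By /andP[? ?]]|]; first by split => //; apply/andP; split; lra.
  rewrite -[-1]/((-1)%:~R) BZ => -[By /andP[? ?]].
  by split => //; apply/andP; split; lra.
have -> : B `&` [set` `[0, 1[] = (B `&` [set` `[t, 1[]) `|` (B `&` [set` `[0, t[]).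
  apply/seteqP; split => y /=; rewrite !in_itv/=.
    by move=> [By /andP[y0 y1]]; have [ty|ty] := ltP y t; [right|left]; rewrite ?ty ?y0.
  by move=> [[By /andP[? ?]]|[By /andP[? ?]]]; split => //; apply/andP; split; lra.
have mt a b : measurable (B `&` [set` `[a, b[] : set (measurableTypeR R)).
  exact: measurableI.
have mt' : measurable ((fun y => y + -1) @^-1` (B `&` [set` `[0, t[]) : set (measurableTypeR R)).
  rewrite -[X in measurable X]setTI.
  exact: (measurable_translation (-1)).
rewrite !measureU//.
- by congr (_ + _)%E; exact: lebesgue_measure_translation.
- apply/seteqP; split => y //= [[_]]; rewrite !in_itv/= => /andP[ty _] [_ /andP[_ yt]].
  by lra.
- apply/seteqP; split => y //= [[_]]; rewrite !in_itv/= => /andP[ty y1] [_ /andP[y1' yt]].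
  by lra.
Qed.

Lemma floor01 y : 0 <= y < 1 -> Num.floor y = 0.
Proof. by move=> y01; apply: floor_def; rewrite add0r. Qed.

(** The arc from 0 to [c], closed at 0 and open at [c]: the left-hand side is the
    fractional part of a representative. *)
Definition circle_arc c : set (circle R) :=
  [set x | let y := repr (x : RmodZ R) in y - (Num.floor y)%:~R < c].

Lemma frac_addz y (n : int) :
  y + n%:~R - (Num.floor (y + n%:~R))%:~R = y - (Num.floor y)%:~R.
Proof. by rewrite floorDrz ?intr_int// intrKfloor intrD; ring. Qed.

Lemma arcE c y : circle_arc c (to_circle y) = (y - (Num.floor y)%:~R < c) :> Prop.
Proof.
rewrite /circle_arc/=; set z := repr _.
have : to_circle z = to_circle y by rewrite to_circleK.
move=> /to_circleP/intrP[n zy]; have -> : z = y + n%:~R by rewrite -zy; ring.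
by rewrite frac_addz.
Qed.

Lemma arc01 c y : 0 <= y < 1 -> circle_arc c (to_circle y) = (y < c) :> Prop.
Proof. by move=> y01; rewrite arcE floor01// subr0. Qed.

Lemma mem_arc c y : (to_circle y \in circle_arc c) = (y - (Num.floor y)%:~R < c).
Proof. by apply/idP/idP; rewrite in_setE arcE. Qed.

(** An arc without its end point 0 is open, and the point 0 is the complement of
    such an open arc of length 1. *)
Lemma measurable_arc c : 0 < c <= 1 -> measurable (circle_arc c).
Proof.
move=> /andP[c0 c1].
have mo b : b <= 1 -> measurable [set x | circle_arc b x /\ ~ x = to_circle 0].
  move=> b1; apply: measurable_circle.
  have -> : @to_circle R @^-1` [set x | circle_arc b x /\ ~ x = to_circle 0] =
     \bigcup_(n : int) [set` `]n%:~R, (n%:~R + b)%R[].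
    apply/seteqP; split => y /=.
      rewrite arcE => -[yb /to_circleP y0]; exists (Num.floor y) => //=.
      rewrite in_itv/= -ltrBlDl yb andbT lt_neqAle floor_le andbT.
      by apply: contraNneq y0 => <-; rewrite subr0 intr_int.
    move=> [n _]; rewrite /= in_itv/= => /andP[ny yn].
    have fy : Num.floor y = n by apply: floor_def; rewrite intrD; apply/andP; split; lra.
    rewrite arcE fy; split; first by lra.
    move=> /to_circleP; rewrite subr0 => /floorK; rewrite fy => yE.
    by move: ny; rewrite yE ltxx.
  by apply: bigcup_open => n _; exact: interval_open.
have -> : circle_arc c = [set x | circle_arc c x /\ ~ x = to_circle 0] `|`
   ~` [set x | circle_arc 1 x /\ ~ x = to_circle 0].
  apply/seteqP; split => x /=.
    move=> cx; have [->|x0] := pselect (x = to_circle 0); last by left.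
    by right; move=> [].
  move=> [[]//|] h; have [->|x0] := pselect (x = to_circle 0).
    by rewrite arc01 ?lexx ?ltr01.
  exfalso; apply: h; split => //.
  by have [y y01 ->] := circleP x; rewrite arc01//; case/andP: y01.
by apply: measurableU; [exact: mo|apply: measurableC; exact: mo].
Qed.

Lemma circle_measure_arc c : 0 <= c <= 1 -> m (circle_arc c) = c%:E.
Proof.
move=> /andP[c0 c1]; rewrite /circle_measure /pushforward /mrestr.
have -> : @to_circle R @^-1` circle_arc c `&` [set` `[0, 1[] = [set` `[0, c[].
  apply/seteqP; split => y /=; rewrite !in_itv/=.
    by move=> [+ y01]; rewrite arc01// => ->; case/andP: y01 => ->.
  by move=> /andP[y0 yc]; have y01 : 0 <= y < 1 by [lra]; rewrite arc01.
rewrite lebesgue_measure_itv/= lte_fin sube0; case: ltP => //.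
by move=> c0'; congr EFin; apply/eqP; rewrite eq_le c0 c0'.
Qed.

Lemma integral_circle (F : circle R -> \bar R) :
  measurable_fun setT F -> (forall x, (0 <= F x)%E) ->
  (\int[m]_x F x = \int[lebesgue_measure]_(y in [set` `[0%R, 1%R[]) F (to_circle y))%E.
Proof.
move=> mF F0.
pose nu : {measure set (measurableTypeR R) -> \bar R} :=
  mrestr (@lebesgue_measure R) (measurable_itv `[0%R, 1%R[).
pose D : set (measurableTypeR R) := [set` `[0%R, 1%R[].
transitivity (\int[nu]_x (F \o @to_circle R) x)%E.
  rewrite -(preimage_setT (@to_circle R)) -ge0_integral_pushforward//.
  exact: measurable_to_circle.
have mD : measurable D by exact: measurable_itv.
have mFc : measurable_fun [set: measurableTypeR R] (F \o @to_circle R).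
  by apply: measurableT_comp => //; exact: measurable_to_circle.
rewrite (@ge0_negligible_integral _ _ _ nu setT (~` D))//.
- rewrite setTD setCK; apply: eq_measure_integral => A mA AD.
  by rewrite -[LHS]/(lebesgue_measure (A `&` D)) setIidl.
- exact: measurableC.
- by move=> y _; exact: F0.
- by rewrite -[LHS]/(lebesgue_measure (~` D `&` D)) setICl measure0.
Qed.

End circle_geometry.

(** * Rotations acting on integrable functions *)

Section rotation_operator.
Context (R : realType).
Local Notation m := (circle_measure R : {measure set (circle R) -> \bar R}).
Implicit Types (phi : L1 m) (s t c y : R) (F : circle R -> R).

Definition rot_op t : L1 m -> L1 m := perron_frobenius (rotation t).

Lemma set_int_rot_op t (A : set (circle R)) phi : measurable A ->
  set_int A (rot_op t phi) = set_int (rotation t @^-1` A) phi.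
Proof.
move=> mA.
apply: (@perron_frobeniusP _ _ _ (circle_measure R) (rotation t) phi) => //.
  exact: measurable_rotation.
by move=> B mB <-; exact: circle_measure_rotation.
Qed.

Lemma rot_op_is_linear t : linear (rot_op t).
Proof.
move=> a f g; apply: L1_set_int_inj => A mA.
have mtA := measurable_preimage_rotation t mA.
by rewrite set_int_rot_op// !(set_intD, set_intZ)// !set_int_rot_op.
Qed.
HB.instance Definition _ t :=
  GRing.isLinear.Build R (L1 m) (L1 m) _ (rot_op t) (rot_op_is_linear t).

Lemma rot_opD s t phi : rot_op s (rot_op t phi) = rot_op (t + s) phi.
Proof.
apply: L1_set_int_inj => A mA.
have msA := measurable_preimage_rotation s mA.
rewrite !set_int_rot_op//; congr set_int; apply/seteqP.
by split => x /=; rewrite rotationD.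
Qed.

Lemma rot_op_int (n : int) phi : rot_op n%:~R phi = phi.
Proof.
by apply: L1_set_int_inj => A mA; rewrite set_int_rot_op// rotation_int.
Qed.

Lemma rot_op0 f : rot_op 0 f = f.
Proof. by rewrite -[X in rot_op X]/(0%:~R) rot_op_int. Qed.

Lemma rot_op_add t f g : rot_op t (f + g) = rot_op t f + rot_op t g.
Proof. exact: linearD. Qed.

Lemma rot_op_scale t a f : rot_op t (a *: f) = a *: rot_op t f.
Proof. exact: linearZ. Qed.

Lemma rot_op_sum t I (s : seq I) (f : I -> L1 m) :
  rot_op t (\sum_(i <- s) f i) = \sum_(i <- s) rot_op t (f i).
Proof. exact: raddf_sum. Qed.

Lemma rot_opC s t phi : rot_op s (rot_op t phi) = rot_op t (rot_op s phi).
Proof. by rewrite !rot_opD addrC. Qed.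

Lemma iter_rot n t phi : iter n (rot_op t) phi = rot_op (t *+ n) phi.
Proof.
elim: n => [|n IH]; first by rewrite mulr0n rot_op0.
by rewrite iterS IH rot_opD mulrSr.
Qed.

Lemma measurable_fun_rotation t F : measurable_fun setT F ->
  measurable_fun setT (F \o rotation t).
Proof. by move=> mF; apply: measurableT_comp => //; exact: measurable_rotation. Qed.

Lemma integral_pushforward_rotation t (A : set (circle R)) (f : circle R -> \bar R) :
  (\int[pushforward m (@rotation R t)]_(x in A) f x = \int[m]_(x in A) f x)%E.
Proof.
apply: eq_measure_integral => [|? B mB _]; first exact: measurable_rotation.
exact: circle_measure_rotation.
Qed.

Lemma integrable_rotation t F : m.-integrable setT (EFin \o F) ->
  m.-integrable setT (EFin \o (F \o rotation t)).
Proof.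
move=> /integrableP[/measurable_EFinP mF iF]; apply/integrableP; split.
  by apply/measurable_EFinP; exact: measurable_fun_rotation.
rewrite (_ : (\int[m]_x `|(EFin \o (F \o rotation t)) x|)%E =
  (\int[m]_x `|(EFin \o F) x|)%E)//.
transitivity (\int[pushforward m (@rotation R t)]_x `|(EFin \o F) x|)%E.
  rewrite (ge0_integral_pushforward (measurable_rotation t))//.
  by apply: measurableT_comp => //; exact/measurable_EFinP.
exact: integral_pushforward_rotation.
Qed.

Lemma Rintegral_rotation t F (A : set (circle R)) : measurable A ->
  m.-integrable setT (EFin \o F) ->
  \int[m]_(x in rotation t @^-1` A) F x = \int[m]_(x in A) F (rotation (- t) x).
Proof.
move=> mA iF; congr fine.
have iFt := integrable_rotation (- t) iF.
have Fid : (EFin \o (F \o rotation (- t))) \o @rotation R t = EFin \o F.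
  apply/funext => x /=; rewrite rotationD addrN.
  by rewrite -[0]/(0%:~R) rotation_int.
transitivity (\int[pushforward m (@rotation R t)]_(x in A) (F (rotation (- t) x))%:E)%E.
  rewrite (@integral_pushforward _ _ _ _ _ (@rotation R t)
    (measurable_rotation t) m A (EFin \o (F \o rotation (- t))))//.
  - by rewrite Fid.
  - by move/integrableP: iFt => [].
  - rewrite Fid; apply: integrableS iF => //.
    exact: measurable_preimage_rotation.
exact: integral_pushforward_rotation.
Qed.

Lemma rot_op_L1_of t F : m.-integrable setT (EFin \o F) ->
  rot_op t (L1_of m F) = L1_of m (F \o rotation (- t)).
Proof.
move=> iF; apply: L1_set_int_inj => A mA.
have mtA := measurable_preimage_rotation t mA.
rewrite set_int_rot_op// !set_int_L1_of//; last exact: integrable_rotation.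
exact: Rintegral_rotation.
Qed.

Lemma L1_of_id phi : L1_of m phi = phi.
Proof. by apply: L1_ae_eq; exact/L1_ofE/integrable_L1. Qed.

Lemma set_int_rotT t phi : set_int setT (rot_op t phi) = set_int setT phi.
Proof. by rewrite set_int_rot_op. Qed.

Lemma measure_circleT : m setT = 1%E. Proof. exact: circle_measure_setT. Qed.

Lemma rot_op_one t : rot_op t (L1_one m) = L1_one m.
Proof. by rewrite /L1_one rot_op_L1_of//; exact: integrable_one measure_circleT. Qed.

Lemma mean_rot t phi : L1_mean (rot_op t phi) = L1_mean phi.
Proof. by rewrite /L1_mean set_int_rotT. Qed.

Lemma rot_op_ge0 t phi : (\forall x \ae m, 0 <= phi x) ->
  \forall x \ae m, 0 <= rot_op t phi x.
Proof.
move=> phi0; have iphi : m.-integrable setT (EFin \o (fun x => `|phi x|)).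
  exact: (integrable_norm (integrable_L1 phi)).
have -> : phi = L1_of m (fun x => `|phi x|).
  apply: L1_ae_eq; move: phi0 (L1_ofE iphi); apply: filterS2 => x h ->.
  by rewrite ger0_norm.
rewrite rot_op_L1_of//; apply: filterS (L1_ofE (integrable_rotation (- t) iphi)) => x -> /=.
exact: normr_ge0.
Qed.

Definition arc_class c : L1 m := L1_of m (\1_(circle_arc c)).

Lemma integrable_indic_circle (A : set (circle R)) : measurable A ->
  m.-integrable setT (EFin \o (\1_A : circle R -> R)).
Proof.
move=> mA; apply: (integrable_bounded measure_circleT (M := 1)) => //.
by move=> x; rewrite indicE normr_nat lern1 leq_b1.
Qed.

Lemma set_int_arc_class c (A : set (circle R)) : 0 < c <= 1 -> measurable A ->
  set_int A (arc_class c) = fine (m (circle_arc c `&` A)).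
Proof.
move=> c01 mA; have mc := measurable_arc c01.
rewrite set_int_L1_of//; last exact: integrable_indic_circle.
by rewrite /Rintegral integral_indic.
Qed.

Lemma norm_L1_of F : m.-integrable setT (EFin \o F) ->
  `|L1_of m F| = \int[m]_x `|F x|.
Proof.
move=> iF; rewrite L1_normE; apply: ae_eq_Rintegral => //.
- by apply: measurableT_comp => //; exact: measurable_L1.
- by apply: measurableT_comp => //; move/integrableP: iF => [/measurable_EFinP].
- by apply: filterS (L1_ofE iF) => x ->.
Qed.

Lemma rot_op_norm t phi : `|rot_op t phi| = `|phi|.
Proof.
have iphi := integrable_L1 phi.
rewrite -{1}(L1_of_id phi) rot_op_L1_of// norm_L1_of; last exact: integrable_rotation.
rewrite L1_normE.
have := @Rintegral_rotation t (fun x => `|phi x|) setT measurableT.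
by rewrite preimage_setT => -> //; exact: (integrable_norm iphi).
Qed.

End rotation_operator.

(** * Step functions on arcs of length 1/q *)

Section step_functions.
Context (R : realType).
Local Notation m := (circle_measure R : {measure set (circle R) -> \bar R}).
Implicit Types (phi : L1 m) (s t c y : R) (F : circle R -> R).

(** The arc from 0 to [c] and its rotate differ only on two arcs of length [t],
    namely from 0 to [t] and from [c] to [c + t]. *)
Lemma norm_rot_arc_sub t c : 0 <= t -> 0 < c -> c + t <= 1 ->
  `|rot_op t (arc_class c) - arc_class c| <= 2 * t.
Proof.
move=> t0 c0 ct1.
have [->|tn0] := eqVneq t 0.
  by rewrite rot_op0 subrr normr0 mulr0.
have {tn0}t0 : 0 < t by rewrite lt0r tn0.
have t01 : 0 < t <= 1 by apply/andP; split; lra.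
have c01 : 0 < c <= 1 by apply/andP; split; lra.
have ct01 : 0 < c + t <= 1 by apply/andP; split; lra.
have iarc a : 0 < a <= 1 -> m.-integrable setT (EFin \o (\1_(circle_arc a) : circle R -> R)).
  by move=> a01; apply: integrable_indic_circle; exact: measurable_arc.
have iarcn a : 0 < a <= 1 ->
    \int[m]_x (\1_(circle_arc a) x : R) = a.
  move=> a01; rewrite /Rintegral integral_indic//; last exact: measurable_arc.
  rewrite setIT [X in fine X](_ : _ = a%:E)//.
  by apply: circle_measure_arc; case/andP: a01 => /ltW -> ->.
rewrite rot_op_L1_of; last exact: iarc.
rewrite norm_L1_ofB; last exact: iarc.
set g := (\1_(circle_arc c) \o _).
have ig : m.-integrable setT (EFin \o g) by exact/integrable_rotation/iarc.
have -> : \int[m]_x `|L1_of m g x - \1_(circle_arc c) x| =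
    \int[m]_x `|g x - \1_(circle_arc c) x|.
  apply: ae_eq_Rintegral => //.
  - apply: measurableT_comp => //; apply: measurable_funB; first exact: measurable_L1.
    by move/integrableP: (iarc _ c01) => [/measurable_EFinP].
  - apply: measurableT_comp => //; apply: measurable_funB.
      by move/integrableP: ig => [/measurable_EFinP].
    by move/integrableP: (iarc _ c01) => [/measurable_EFinP].
  - by apply: filterS (L1_ofE ig) => x ->.
have i1 : m.-integrable setT
    (EFin \o (\1_(circle_arc (c + t)) \- \1_(circle_arc c) : circle R -> R)).
  by apply: (@integrableB _ _ _ m setT measurableT) (iarc _ ct01) (iarc _ c01).
have i2 : m.-integrable setT (EFin \o (\1_(circle_arc t) \+
    (\1_(circle_arc (c + t)) \- \1_(circle_arc c)) : circle R -> R)).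
  exact: (@integrableD _ _ _ m setT measurableT) (iarc _ t01) i1.
apply: (@le_trans _ _ (\int[m]_x (\1_(circle_arc t) x +
    (\1_(circle_arc (c + t)) \- \1_(circle_arc c)) x))); last first.
  rewrite RintegralD//; [|exact: iarc].
  by rewrite RintegralB//; [|exact: iarc|exact: iarc]; rewrite !iarcn//; lra.
apply: le_Rintegral => //.
  apply: (integrable_norm (f := fun x => g x - \1_(circle_arc c) x)).
  exact: (@integrableB _ _ _ m setT measurableT) ig (iarc _ c01).
move=> x _; have [y /andP[y0 y1] ->] := circleP x.
rewrite /g /= rotationE !indicE !mem_arc (@floor01 _ y) ?y0// subr0.
have [yt|ty] := ltP y t.
  have le1 (a b : bool) : `|a%:R - b%:R| <= 1 :> R.
    by case: a; case: b; rewrite ?subrr ?subr0 ?sub0r ?normrN ?normr0 ?normr1.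
  apply: le_trans (le1 _ _) _; rewrite lerDl subr_ge0 ler_nat.
  by have [yc|//] := ltP y c; rewrite ltr_wpDr// ltW.
rewrite (@floor01 _ (y - t)); last by apply/andP; split; lra.
rewrite subr0 ltrBlDr add0r.
have [yct|yct] := ltP y (c + t); have [yc|yc] := ltP y c; rewrite ?subrr ?normr0 ?subr0 ?normr1//.
by exfalso; lra.
Qed.

(** The rotates of the arc of length 1/q by the multiples of 1/q tile the circle,
    and the index of the tile of [y] is the integer part of [q y]. *)
Lemma arc_rotE (q : nat) (j : nat) y : (j < q)%N -> 0 <= y < 1 ->
  (rotation (- (j%:R / q%:R)) (to_circle y) \in circle_arc q%:R^-1) =
  (Num.truncn (q%:R * y) == j).
Proof.
move=> jq /andP[y0 y1]; rewrite rotationE mem_arc.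
have q0 : 0 < q%:R :> R by rewrite ltr0n (leq_ltn_trans _ jq).
have qV0 : 0 < q%:R^-1 :> R by rewrite invr_gt0.
rewrite truncn_eq; last by rewrite mulr_ge0// ltW.
have [yj|jy] := ltP y (j%:R / q%:R).
  have -> : j%:R <= q%:R * y = false.
    by apply/negbTE; rewrite -ltNge mulrC -ltr_pdivlMr.
  have jq1 : j%:R / q%:R <= 1 - q%:R^-1 :> R.
    by rewrite ler_pdivrMr// mulrBl mul1r mulVf ?gt_eqF// lerBrDr natr1 ler_nat.
  rewrite (_ : Num.floor _ = -1); last first.
    by apply: floor_def; rewrite addNr mulrN1z mulr0z; apply/andP; split; lra.
  by apply/negbTE; rewrite -leNgt mulrN1z; lra.
have -> : j%:R <= q%:R * y by rewrite mulrC -ler_pdivrMr.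
rewrite (@floor01); last by rewrite subr_ge0 jy/=; have : 0 <= j%:R / q%:R :> R; [rewrite divr_ge0|lra].
rewrite subr0 ltrBlDr (_ : _ + _ = j.+1%:R / q%:R); last first.
  by rewrite -natr1 mulrDl mul1r addrC.
by rewrite ltr_pdivlMr// mulrC.
Qed.

Definition step (q : nat) (c : nat -> R) : L1 m :=
  \sum_(j < q) c j *: rot_op (j%:R / q%:R) (arc_class (q%:R^-1 : R)).

Definition step_fun (q : nat) (c : nat -> R) (x : circle R) : R :=
  \sum_(j < q) c j *
    \1_(circle_arc q%:R^-1) (rotation (- (j%:R / q%:R)) x).

Lemma step_fun_to_circle q (c : nat -> R) y : (0 < q)%N -> 0 <= y < 1 ->
  step_fun q c (to_circle y) = c (Num.truncn (q%:R * y)).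
Proof.
move=> q0 /andP[y0 y1].
have tq : (Num.truncn (q%:R * y) < q)%N.
  by rewrite truncn_lt_nat ?mulr_ge0// gtr_pMr ?ltr0n.
rewrite /step_fun (bigD1 (Ordinal tq))//= big1 ?addr0; last first.
  move=> i ineq; rewrite indicE arc_rotE ?y0// eq_sym.
  by rewrite (_ : _ == _ = false) ?mulr0//; apply/negbTE; rewrite -val_eqE in ineq.
by rewrite indicE arc_rotE ?y0// eqxx mulr1.
Qed.

Lemma ae_eq_L1_sum I (s : seq I) (f : I -> L1 m) (F : I -> circle R -> R) :
  (forall i, \forall x \ae m, f i x = F i x) ->
  \forall x \ae m, (\sum_(i <- s) f i : L1 m) x = \sum_(i <- s) F i x.
Proof.
move=> fF; elim: s => [|i s IH].
  have h := L1_scaleE 0 (0 : L1 m); rewrite scale0r in h.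
  by apply: filterS h => x; rewrite !big_nil mul0r.
have h := L1_addE (f i) (\sum_(i <- s) f i).
by move: h (fF i) IH; apply: filterS3 => x; rewrite !big_cons => -> -> ->.
Qed.

Lemma step_ae q (c : nat -> R) : (0 < q)%N -> \forall x \ae m, step q c x = step_fun q c x.
Proof.
move=> q0; apply: ae_eq_L1_sum => j.
have q01 : 0 < (q%:R^-1 : R) <= 1.
  by rewrite invr_gt0 ltr0n q0 invf_le1 ?ltr0n// ler1n.
have iarc := integrable_indic_circle (measurable_arc q01).
have h1 := L1_scaleE (c j) (rot_op (j%:R / q%:R) (arc_class (q%:R^-1 : R))).
have h2 := L1_ofE (integrable_rotation (- (j%:R / q%:R)) iarc).
move: h1; rewrite {2}/arc_class (rot_op_L1_of _ iarc) => h1.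
by move: h1 h2; apply: filterS2 => x -> ->.
Qed.

(** Uniform continuity on the compact interval [0, 1]: the grid point below [y]
    is within 1/q of [y]. *)
Lemma step_uniform (g : R -> R) (e : R) : 0 < e -> continuous g ->
  \forall q \near \oo, forall y, 0 <= y < 1 ->
    `|g y - g ((Num.truncn (q%:R * y))%:R / q%:R)| <= e.
Proof.
move=> e0 cg.
have /compact_near_coveringP/near_covering_withinP : compact `[0 : R, 1].
  exact: segment_compact.
move=> /(_ nat \oo (fun q y => 0 <= y < 1 ->
    `|g y - g ((Num.truncn (q%:R * y))%:R / q%:R)| <= e) _) H.
have {}H := H _.
suff : \forall q \near \oo, `[0 : R, 1] `<=` (fun y => 0 <= y < 1 ->
    `|g y - g ((Num.truncn (q%:R * y))%:R / q%:R)| <= e).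
  by apply: filterS => q h y y01; apply: h => //=; rewrite in_itv/=; case/andP: y01 => -> /ltW.
apply: H => x _.
have /cvgrPdist_lt /(_ (e / 2)) : g z @[z --> x] --> g x by exact: cg.
have e20 : 0 < e / 2 by rewrite divr_gt0.
move=> /(_ e20) /nbhs_ballP[d /= d0 gd].
exists (ball x (d / 2), [set q : nat | d^-1 * 2 < q%:R]).
  split => /=; first by apply: nbhsx_ballx; rewrite divr_gt0.
  exact: nbhs_infty_gtr.
move=> [y q] /= [xy qd] _ y01.
have q0 : 0 < q%:R :> R by apply: lt_trans qd; rewrite mulr_gt0 ?invr_gt0.
have yq0 : 0 <= q%:R * y by rewrite mulr_ge0 ?(ltW q0)//; case/andP: y01.
have /andP[ty yt] := truncn_itv yq0.
set z := _ / q%:R.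
have zy : z <= y by rewrite /z ler_pdivrMr// [y * _]mulrC.
have yz : y < z + d / 2.
  apply: lt_trans (_ : z + q%:R^-1 < _).
    by rewrite -[X in _ + X]mul1r -mulrDl natr1 ltr_pdivlMr// [y * _]mulrC.
  rewrite ltrD2l invf_plt ?posrE ?divr_gt0//.
  by rewrite invfM invrK.
have xd := xy; rewrite /ball/= ltr_norml in xd; case/andP: xd => xd1 xd2.
have h1 : `|g x - g y| < e / 2.
  by apply: gd; rewrite /ball/= ltr_norml; apply/andP; split; lra.
have h2 : `|g x - g z| < e / 2.
  by apply: gd; rewrite /ball/= ltr_norml; apply/andP; split; lra.
rewrite (_ : g y - g z = (g x - g z) - (g x - g y)); last by ring.
by apply: le_trans (ler_normB _ _) _; lra.
Qed.

Lemma measurable_step_fun q (c : nat -> R) : (0 < q)%N ->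
  measurable_fun setT (step_fun q c).
Proof.
move=> q0; apply: measurable_sum => j.
apply: measurable_funM => //; apply: measurable_fun_rotation.
apply: measurable_indic; apply: measurable_arc.
by rewrite invr_gt0 ltr0n q0 invf_le1 ?ltr0n// ler1n.
Qed.

(** The class is approximated by a continuous function on a period of the line,
    which is then sampled at the multiples of 1/q. Taking [1 < q] makes the arcs
    proper, so that they can be rotated slightly without wrapping around. *)
Lemma step_dense (phi : L1 m) (e : R) : 0 < e ->
  exists (q : nat) (c : nat -> R), (1 < q)%N /\ `|phi - step q c| <= e.
Proof.
move=> e0; have e20 : 0 < e / 2 by rewrite divr_gt0.
pose D : set (measurableTypeR R) := [set` `[0%R, 1%R[].
have mD : measurable D by exact: measurable_itv.
have muD : lebesgue_measure D = 1%E by rewrite lebesgue_measure_itv/= lte01 sube0.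
pose f (y : R) := phi (to_circle y).
have mf : measurable_fun [set: measurableTypeR R] f.
  by apply: measurableT_comp; [exact: measurable_L1|exact: measurable_to_circle].
have intf : lebesgue_measure.-integrable D (EFin \o f).
  apply/integrableP; split; first by apply/measurable_EFinP; exact: measurable_funTS.
  rewrite -(@integral_circle R (fun x => `|(phi x)%:E|%E))//; last first.
    by apply: measurableT_comp => //; apply/measurable_EFinP; exact: measurable_L1.
  by have /integrableP[_] := integrable_L1 phi.
have Dfin : (lebesgue_measure D < +oo)%E by rewrite muD ltry.
have [g_ [cg _ gf]] := approximation_continuous_integrable mD Dfin intf.
have [g cg_ fg] : exists2 g : R -> R, continuous g &
    (\int[lebesgue_measure]_(y in D) `|(f y - g y)%:E| < (e / 2)%:E)%E.
  have : \forall n \near \oo,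
      (\int[lebesgue_measure]_(y in D) `|(f y - g_ n y)%:E| < (e / 2)%:E)%E.
    have h : (0%E < (e / 2)%:E)%E by rewrite lte_fin.
    exact: (gf _ (open_ereal_lt' h)).
  by move=> [n _ /(_ n (leqnn n))] h; exists (g_ n).
have [q [q1 gq]] : exists q, (1 < q)%N /\ forall y, 0 <= y < 1 ->
    `|g y - g ((Num.truncn (q%:R * y))%:R / q%:R)| <= e / 2.
  have [n _ h] := step_uniform e20 cg_.
  by exists (maxn 2 n); split; [exact: leq_maxl|apply: h; exact: leq_maxr].
pose c j := g (j%:R / q%:R); exists q, c; split => //.
have q0 : (0 < q)%N by exact: ltnW.
have mstep := measurable_step_fun c q0.
rewrite L1_normE (_ : Rintegral _ _ _ = \int[m]_x `|phi x - step_fun q c x|); last first.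
  apply: ae_eq_Rintegral => //.
  - by apply: measurableT_comp => //; exact: measurable_L1.
  - by apply: measurableT_comp => //; apply: measurable_funB => //; exact: measurable_L1.
  - have := L1_addE phi (- step q c); have := L1_scaleE (-1) (step q c).
    rewrite scaleN1r; move: (step_ae c q0).
    by apply: filterS3 => x h1 h2 ->; rewrite h2 h1 mulN1r.
have mdiff : measurable_fun setT (fun x : circle R => `|phi x - step_fun q c x|%:E).
  apply/measurable_EFinP; apply: measurableT_comp => //.
  by apply: measurable_funB => //; exact: measurable_L1.
rewrite /Rintegral (@integral_circle R (fun x => `|phi x - step_fun q c x|%:E))//.
have bnd : (\int[lebesgue_measure]_(y in D)
    `|phi (to_circle y) - step_fun q c (to_circle y)|%:E <= e%:E)%E.
  apply: (@le_trans _ _ (\int[lebesgue_measure]_(y in D) (`|(f y - g y)%:E| + (e / 2)%:E))%E).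
    apply: ge0_le_integral => //.
    - have /measurable_funTS := measurableT_comp mdiff (@measurable_to_circle R).
      exact.
    - apply: emeasurable_funD => //; apply: measurableT_comp => //.
      apply/measurable_EFinP/measurable_funB; first exact: measurable_funTS.
      by apply: measurable_funTS; exact: continuous_measurable_fun.
    - move=> y; rewrite /D /= in_itv/= => y01.
      rewrite step_fun_to_circle// -EFinD lee_fin.
      rewrite (_ : _ - _ = (f y - g y) + (g y - c (Num.truncn (q%:R * y)))); last first.
        by rewrite /f; ring.
      by apply: le_trans (ler_normD _ _) _; rewrite lerD2l gq.
  rewrite ge0_integralD//.
  - rewrite (_ : (\int[_]_(x in D) (e / 2)%:E = (e / 2)%:E)%E); last first.
      by rewrite integral_cst// [X in (_ * X)%E](_ : _ = 1%E) ?mule1.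
    rewrite [leRHS](_ : _ = (e / 2)%:E + (e / 2)%:E)%E; last first.
      by rewrite -EFinD -splitr.
    by rewrite leeD2r// ltW.
  - apply: measurableT_comp => //.
    apply/measurable_EFinP/measurable_funB; first exact: measurable_funTS.
    by apply: measurable_funTS; exact: continuous_measurable_fun.
  - by move=> y _; rewrite lee_fin ltW.
rewrite -[leRHS]/(fine e%:E); apply: fine_le => //.
rewrite ge0_fin_numE; last by apply: integral_ge0 => y _; rewrite lee_fin.
by apply: le_lt_trans bnd _; rewrite ltry.
Qed.

End step_functions.

(** * Density of the multiples of an irrational *)

Section kronecker.
Context (R : realType).
Implicit Types (theta t e : R).

(** Pigeonhole: among K + 1 multiples, two have their fractional parts in the
    same of the K intervals of length 1/K. *)
Lemma small_multiple theta e : irrational theta -> 0 < e ->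
  exists (n : nat) (k : int), 0 < `|n%:R * theta - k%:~R| < e.
Proof.
move=> irr e0.
pose fr (n : nat) : R := n%:R * theta - (Num.floor (n%:R * theta))%:~R.
have fr01 n : 0 <= fr n < 1 by exact: frac01.
pose K := (Num.truncn e^-1).+1.
have eK : e^-1 < K%:R by exact: truncnS_gt.
have K0 : 0 < K%:R :> R by rewrite ltr0n.
have cellP (i : 'I_K.+1) : (Num.truncn (K%:R * fr i) < K)%N.
  have /andP[f0 f1] := fr01 i.
  by rewrite truncn_lt_nat ?mulr_ge0// gtr_pMr.
pose cell i := Ordinal (cellP i).
have /injectivePn[i [j ij cij]] : ~~ injectiveb cell.
  by apply/negP => /injectiveP/leq_card; rewrite !card_ord ltnn.
wlog ltij : i j ij cij / (i < j)%N.
  move=> wl; have [|ji|/val_inj/eqP] := ltngtP i j; first exact: wl.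
    by apply: (wl j i) => //; rewrite eq_sym.
  by rewrite (negbTE ij).
pose k := Num.floor (j%:R * theta) - Num.floor (i%:R * theta).
exists (j - i)%N, k.
have -> : (j - i)%:R * theta - k%:~R = fr j - fr i.
  by rewrite natrB ?(ltnW ltij)// /k /fr intrB; ring.
have close : `|fr j - fr i| < K%:R^-1.
  have /andP[fi0 _] := fr01 i; have /andP[fj0 _] := fr01 j.
  have /andP[ci1 ci2] := truncn_itv (mulr_ge0 (ltW K0) fi0).
  have /andP[cj1 cj2] := truncn_itv (mulr_ge0 (ltW K0) fj0).
  move: cij => /(congr1 val)/= cij; rewrite cij -natr1 in ci1 ci2.
  rewrite -natr1 in cj2.
  rewrite -(ltr_pM2l K0) mulfV ?gt_eqF// -[X in X * _](gtr0_norm K0) -normrM mulrBr.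
  by rewrite ltr_norml; apply/andP; split; lra.
apply/andP; split; last by apply: lt_trans close _; rewrite invf_plt ?posrE.
rewrite normr_gt0; apply/eqP => fij; apply: irr; apply/rationalP.
exists k, (j - i)%N; apply/eqP.
rewrite eq_sym -subr_eq0 in fij *.
have ji0 : (j - i)%:R != 0 :> R by rewrite pnatr_eq0 -lt0n subn_gt0.
have : (j - i)%:R * theta = k%:~R.
  by rewrite natrB ?(ltnW ltij)//; move: fij; rewrite /k /fr intrB; lra.
by move=> <-; rewrite mulrC mulKf// subrr.
Qed.

(** Kronecker's theorem. The multiples of a small step [d] reach every point up
    to [|d|], once the starting integer is on the side from which [d] leads to
    [t]. *)
Lemma kronecker theta t e : irrational theta -> 0 < e ->
  exists (n : nat) (k : int), `|n%:R * theta + k%:~R - t| < e.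
Proof.
move=> irr e0; have [n [k /andP[d0 de]]] := small_multiple irr e0.
set d := n%:R * theta - k%:~R in d0 de.
have dn0 : d != 0 by rewrite -normr_gt0.
have [l tl] : exists l : int, 0 <= (t - l%:~R) / d.
  have [dp|dn] := ltP 0 d.
    by exists (Num.floor t); rewrite divr_ge0 ?(ltW dp)// subr_ge0 floor_le.
  exists (Num.floor t + 1); rewrite -mulrNN -invrN divr_ge0// ?oppr_ge0//.
  by rewrite subr_le0 ltW// floorD1_gt.
have /andP[j1 j2] := truncn_itv tl; set j := Num.truncn _ in j1 j2.
exists (j * n)%N, (l - j%:Z * k).
have -> : (j * n)%:R * theta + (l - j%:Z * k)%:~R - t = d * (j%:R - (t - l%:~R) / d).
  rewrite mulrBr [d * (_ / d)]mulrC divfK// /d natrM intrB intrM; ring.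
rewrite normrM; apply: le_lt_trans de.
rewrite ger_pMr// ler_norml -natr1 in j2 *; apply/andP; split; lra.
Qed.

End kronecker.

(** * The mean ergodic theorem for irrational rotations *)

(** Closedness is stated as stability under approximation in norm, which is how
    it is established and used below. *)
Definition closed_subspace (R : realType) (V : normedModType R) (W : set V) :=
  [/\ W 0, forall a f g, W f -> W g -> W (a *: f + g) &
   forall f, (forall e : R, 0 < e -> exists2 g, W g & `|f - g| <= e) -> W f].

Section closed_subspace_theory.
Context (R : realType) (V : normedModType R) (W : set V).
Hypothesis clW : closed_subspace W.

Lemma closed_subspaceD f g : W f -> W g -> W (f + g).
Proof. by case: clW => _ WD _ Wf Wg; rewrite -(scale1r f); exact: WD. Qed.

Lemma closed_subspaceZ a f : W f -> W (a *: f).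
Proof. by case: clW => W0 WD _ Wf; rewrite -(addr0 (a *: f)); exact: WD. Qed.

Lemma closed_subspaceB f g : W f -> W g -> W (f - g).
Proof.
by move=> Wf Wg; apply: closed_subspaceD => //; rewrite -scaleN1r; exact: closed_subspaceZ.
Qed.

Lemma closed_subspace_sum I (s : seq I) (f : I -> V) :
  (forall i, W (f i)) -> W (\sum_(i <- s) f i).
Proof.
case: (clW) => W0 _ _ Wf; elim/big_ind : _ => //.
by move=> g h; exact: closed_subspaceD.
Qed.

End closed_subspace_theory.

Section cyclic_average.
Context (R : realType).
Local Notation m := (circle_measure R : {measure set (circle R) -> \bar R}).
Implicit Types (f g h : L1 m) (t gamma : R).

(** Telescoping: [f - T^n f] is the sum of the [g - T g] for [g = T^i f]. *)
Lemma coboundary_iter (W : set (L1 m)) gamma n f : closed_subspace W ->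
  (forall f, W (f - rot_op gamma f)) -> W (f - rot_op (gamma *+ n) f).
Proof.
move=> clW cob; elim: n => [|n IH].
  by rewrite mulr0n rot_op0 subrr; case: clW.
rewrite (_ : _ - _ = (f - rot_op (gamma *+ n) f) +
  (rot_op (gamma *+ n) f - rot_op gamma (rot_op (gamma *+ n) f))).
  by apply: (closed_subspaceD clW); [exact: IH|exact: cob].
by rewrite rot_opD -mulrSr addrA subrK.
Qed.

(** When [gamma *+ q] is an integer, this is the projection onto the classes
    invariant under the rotation by [gamma]. *)
Definition cyclic_avg gamma (q : nat) f : L1 m :=
  q%:R^-1 *: \sum_(j < q) rot_op (gamma *+ j) f.

Lemma rot_op_cyclic_avgC t gamma q f :
  rot_op t (cyclic_avg gamma q f) = cyclic_avg gamma q (rot_op t f).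
Proof.
rewrite /cyclic_avg rot_op_scale rot_op_sum; apply: (congr1 (fun z => q%:R^-1 *: z)).
by apply: eq_bigr => j _; exact: rot_opC.
Qed.

Lemma rot_op_cyclic_avg gamma q f : gamma *+ q \is a Num.int ->
  rot_op gamma (cyclic_avg gamma q f) = cyclic_avg gamma q f.
Proof.
move=> /intrP[k gq]; rewrite /cyclic_avg rot_op_scale rot_op_sum.
apply: (congr1 (fun z => q%:R^-1 *: z)).
apply: (@addrI _ (rot_op (gamma *+ 0) f)).
transitivity (\sum_(j < q.+1) rot_op (gamma *+ j) f).
  rewrite big_ord_recl; congr (_ + _); apply: eq_bigr => j _.
  by rewrite rot_opD -mulrSr.
by rewrite big_ord_recr/= gq rot_op_int ?mulr0n rot_op0 addrC.
Qed.

Lemma coboundary_cyclic_avg (W : set (L1 m)) gamma q f : closed_subspace W ->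
  (forall f, W (f - rot_op gamma f)) -> (0 < q)%N -> W (f - cyclic_avg gamma q f).
Proof.
move=> clW cob q0.
rewrite (_ : _ - _ = q%:R^-1 *: \sum_(j < q) (f - rot_op (gamma *+ j) f)); last first.
  rewrite sumrB sumr_const card_ord scalerBr -[f *+ q]scaler_nat.
  by rewrite scalerA mulVf ?scale1r// pnatr_eq0 -lt0n.
apply: (closed_subspaceZ clW); apply: (closed_subspace_sum clW) => j.
exact: coboundary_iter.
Qed.

End cyclic_average.

Section mean_ergodic.
Context (R : realType).
Local Notation m := (circle_measure R : {measure set (circle R) -> \bar R}).
Implicit Types (phi : L1 m) (s t c y : R).

Lemma sum_rot_arc (q : nat) : (0 < q)%N ->
  \sum_(j < q) rot_op (j%:R / q%:R) (arc_class (q%:R^-1 : R)) = L1_one m.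
Proof.
move=> q0; have -> : L1_one m = step q (cst 1).
  apply: L1_ae_eq.
  move: (step_ae (cst (1 : R)) q0) (L1_ofE (integrable_one (measure_circleT R))).
  apply: filterS2 => x -> h; rewrite [LHS]h /=.
  by have [y y01 ->] := circleP x; rewrite step_fun_to_circle.
by apply: eq_bigr => j _; rewrite scale1r.
Qed.

(** Mean ergodic theorem for an irrational rotation [T]: the closed span of the
    coboundaries [phi - T phi] contains every class of mean 0. Arcs suffice, for
    their rotates depend continuously on the angle, the rotates of an arc of
    length 1/q by the multiples of 1/q add up to 1, and step functions are dense. *)
Lemma mean_ergodic theta (W : set (L1 m)) : irrational theta ->
  closed_subspace W -> (forall phi, W (phi - rot_op theta phi)) ->
  forall phi, W (phi - L1_mean phi).
Proof.
move=> irr clW cob.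
have WZ := closed_subspaceZ clW.
have WB := closed_subspaceB clW; have Wsum := closed_subspace_sum clW.
have Wcl := let: And3 _ _ h := clW in h.
(* Some multiple of theta is so close to t modulo 1 that the corresponding
   rotates of the arc are e-close in norm. *)
have cobt c t : 0 < c < 1 -> W (arc_class c - rot_op t (arc_class c)).
  move=> /andP[c0 c1]; apply: Wcl => e e0.
  pose e' := Num.min (e / 2) (1 - c).
  have e'0 : 0 < e' by rewrite lt_min divr_gt0//= subr_gt0.
  have [n [k nk]] := kronecker t irr e'0.
  exists (arc_class c - rot_op (n%:R * theta) (arc_class c)).
    by rewrite mulr_natl; exact: coboundary_iter.
  set s := n%:R * theta + k%:~R in nk.
  have -> : rot_op (n%:R * theta) (arc_class c) = rot_op s (arc_class c).
    by rewrite /s -rot_opD rot_op_int.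
  have {nk} : `|s - t| <= e' by rewrite ltW.
  rewrite le_min => /andP[ste stc].
  rewrite opprB addrC addrA subrK.
  have near_le a b : 0 <= a - b <= 1 - c -> `|a - b| <= e / 2 ->
      `|rot_op a (arc_class c) - rot_op b (arc_class c)| <= e.
    move=> /andP[ab0 abc] abe.
    have -> : rot_op a (arc_class c) = rot_op b (rot_op (a - b) (arc_class c)).
      by rewrite rot_opD subrK.
    rewrite -linearB rot_op_norm; apply: le_trans (norm_rot_arc_sub ab0 c0 _) _.
      by lra.
    by move: abe; rewrite ger0_norm//; lra.
  have [st|st] := leP t s.
    by apply: near_le => //; rewrite subr_ge0 st/=; move: stc; rewrite ger0_norm ?subr_ge0.
  rewrite distrC; apply: near_le; last by rewrite distrC.
  by rewrite subr_ge0 (ltW st)/=; move: stc; rewrite distrC ger0_norm// subr_ge0 ltW.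
have Wstep q w : (1 < q)%N -> W (step q w - L1_mean (step q w)).
  move=> q1; have q0 : (0 < q)%N by exact: ltnW.
  pose a := arc_class (q%:R^-1 : R).
  have q01 : 0 < (q%:R^-1 : R) < 1 by rewrite invr_gt0 ltr0n q0 invf_lt1 ?ltr0n// ltr1n.
  (* 1 is the sum of the q rotates of a, so a - 1/q is an average of
     differences a - T_t a. *)
  have Wa : W (a - q%:R^-1 *: L1_one m).
    have -> : a - q%:R^-1 *: L1_one m =
        q%:R^-1 *: \sum_(j < q) (a - rot_op (j%:R / q%:R) a).
      rewrite sumrB sumr_const card_ord sum_rot_arc// scalerBr -[a *+ q]scaler_nat.
      by rewrite scalerA mulVf ?scale1r// pnatr_eq0 -lt0n.
    by apply: WZ; apply: Wsum => j; exact: cobt.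
  have ma : L1_mean a = q%:R^-1 *: L1_one m.
    rewrite /L1_mean; congr (_ *: _).
    have := @set_int_one _ _ _ m (measure_circleT R).
    rewrite -(sum_rot_arc q0) set_int_sum//.
    under eq_bigr do rewrite set_int_rotT.
    rewrite sumr_const card_ord -/a => h.
    by apply: (mulfI (x := q%:R)); rewrite ?mulfV ?pnatr_eq0 -?lt0n// mulr_natl.
  rewrite /step raddf_sum /= -sumrB; apply: Wsum => j.
  have -> : L1_mean (w j *: rot_op (j%:R / q%:R) a) =
    w j *: L1_mean (rot_op (j%:R / q%:R) a) by exact: linearZ.
  rewrite -scalerBr; apply: WZ; rewrite mean_rot -/a.
  rewrite (_ : _ - _ = (a - L1_mean a) - (a - rot_op (j%:R / q%:R) a)).
    by apply: WB; [rewrite ma|exact: cobt].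
  by rewrite opprB [RHS]addrC addrA subrK.
move=> phi; apply: Wcl => e e0.
have e20 : 0 < e / 2 by rewrite divr_gt0.
have [q [w [q1 phiw]]] := step_dense phi e20.
exists (step q w - L1_mean (step q w)); first exact: Wstep.
rewrite (_ : _ - _ = (phi - step q w) - L1_mean (phi - step q w)); last first.
  have -> : L1_mean (phi - step q w) = L1_mean phi - L1_mean (step q w).
    exact: linearB.
  by rewrite !opprB addrACA [RHS]addrACA; congr (_ + _); rewrite addrC.
apply: le_trans (ler_normB _ _) _.
have := norm_L1_mean (measure_circleT R) (phi - step q w); lra.
Qed.

End mean_ergodic.

(** * Powers of the average of a contraction and the identity *)

Section binomial_sums.
Context (R : realType).

Lemma sum_binS (V : lmodType R) n (g : nat -> V) :
  \sum_(k < n.+2) 'C(n.+1, k)%:R *: g k =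
  \sum_(k < n.+1) 'C(n, k)%:R *: g k + \sum_(k < n.+1) 'C(n, k)%:R *: g k.+1.
Proof.
rewrite big_ord_recl bin0.
under eq_bigr do rewrite binS natrD scalerDl.
rewrite big_split/= addrA; congr (_ + _).
rewrite [RHS]big_ord_recl bin0; congr (_ + _).
by rewrite big_ord_recr/= bin_small// scale0r addr0.
Qed.

Lemma sum_bin n : \sum_(k < n.+1) 'C(n, k)%:R = 2 ^+ n :> R.
Proof.
by rewrite -[2]/(1 + 1) exprDn; apply: eq_bigr => k _; rewrite !expr1n mulr1.
Qed.

(** The variance of the difference between heads and tails in [n] tosses. *)
Lemma sum_bin_variance n :
  \sum_(k < n.+1) 'C(n, k)%:R * (n%:R - 2 * k%:R) ^+ 2 = n%:R * 2 ^+ n :> R.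
Proof.
elim: n => [|n IH]; first by rewrite big_ord1/= mulr0 subr0 expr0n mulr0 mul0r.
have := @sum_binS R^o n (fun k => (n.+1%:R - 2 * k%:R) ^+ 2).
rewrite /GRing.scale/= => ->; rewrite -big_split/=.
transitivity (2 * \sum_(k < n.+1) 'C(n, k)%:R * (n%:R - 2 * k%:R) ^+ 2 +
  2 * \sum_(k < n.+1) 'C(n, k)%:R : R).
  rewrite !mulr_sumr -big_split/=; apply: eq_bigr => k _.
  by rewrite -(natr1 n) -(natr1 k); ring.
by rewrite IH sum_bin exprS -natr1; ring.
Qed.

(** With [N = n + 1], both C(n, k) and C(n, k - 1) are fractions of C(N, k),
    namely (N - k)/N and k/N. *)
Lemma sum_bin_difference (V : lmodType R) n (g : nat -> V) :
  \sum_(k < n.+1) 'C(n, k)%:R *: g k - \sum_(k < n.+1) 'C(n, k)%:R *: g k.+1 =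
  \sum_(k < n.+2) ('C(n.+1, k)%:R * ((n.+1%:R - 2 * k%:R) / n.+1%:R)) *: g k.
Proof.
have n0 : n.+1%:R != 0 :> R by rewrite pnatr_eq0.
have -> : \sum_(k < n.+1) 'C(n, k)%:R *: g k =
    \sum_(k < n.+2) ('C(n.+1, k)%:R * ((n.+1%:R - k%:R) / n.+1%:R)) *: g k.
  rewrite [RHS]big_ord_recr/= subrr mul0r mulr0 scale0r addr0.
  apply: eq_bigr => k _; congr (_ *: _).
  apply: (mulfI n0); rewrite mulrCA [n.+1%:R * (_ / _)]mulrC divfK//.
  by rewrite -natrB ?(ltnW (ltn_ord k))// -!natrM [in RHS]mulnC mul_bin_down.
have -> : \sum_(k < n.+1) 'C(n, k)%:R *: g k.+1 =
    \sum_(k < n.+2) ('C(n.+1, k)%:R * (k%:R / n.+1%:R)) *: g k.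
  rewrite [RHS]big_ord_recl/= mul0r mulr0 scale0r add0r.
  apply: eq_bigr => k _; congr (_ *: _).
  apply: (mulfI n0); rewrite mulrCA [n.+1%:R * (_ / _)]mulrC divfK//.
  by rewrite -!natrM (mul_bin_diag n.+1) mulnC.
rewrite -sumrB; apply: eq_bigr => k _; rewrite -scalerBl -mulrBr; congr ((_ * _) *: _).
by rewrite -mulrBl; congr (_ / _); ring.
Qed.

End binomial_sums.

Lemma halves (R : realType) : 2^-1 + 2^-1 = 1 :> R.
Proof. by field. Qed.

Section half_sum.
Context (R : realType) (V : normedModType R) (U : {linear V -> V}).
Hypothesis normU : forall f, `|U f| <= `|f|.

Definition half_sum (f : V) : V := 2^-1 *: f + 2^-1 *: U f.

Lemma iter_half_sum n f :
  iter n half_sum f = (2 ^- n) *: \sum_(k < n.+1) 'C(n, k)%:R *: iter k U f.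
Proof.
elim: n => [|n IH]; first by rewrite big_ord1/= bin0 scale1r expr0 invr1 scale1r.
have UZ a x : U (a *: x) = a *: U x by exact: linearZ.
have Usum : U (\sum_(k < n.+1) 'C(n, k)%:R *: iter k U f) =
    \sum_(k < n.+1) 'C(n, k)%:R *: iter k.+1 U f.
  by rewrite raddf_sum; apply: eq_bigr => k _; exact: linearZ.
rewrite iterS IH /half_sum UZ Usum (sum_binS _ (fun k => iter k U f)).
by rewrite -!scalerDr scalerA exprS invfM.
Qed.

Lemma half_sum_fixed f : U f = f -> half_sum f = f.
Proof. by rewrite /half_sum => ->; rewrite -scalerDl halves scale1r. Qed.

Lemma norm_iter k f : `|iter k U f| <= `|f|.
Proof. by elim: k => //= k IH; apply: le_trans (normU _) IH. Qed.

(** Up to the factor [|f|], the norm is at most twice the mean of |N - 2 K|/N for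
    the number [K] of heads in [N = n + 1] tosses. The inequality 2 |x| <= x^2/s + s reduces this to the
    variance; optimising [s] would give the rate N^(-1/2). *)
Lemma norm_iter_half_sum n f s : 0 < s ->
  `|iter n half_sum (f - U f)| <= (s^-1 + s / n.+1%:R) * `|f|.
Proof.
move=> s0; have N0 : 0 < n.+1%:R :> R by rewrite ltr0n.
have two0 : 0 < 2 ^+ n :> R by rewrite exprn_gt0.
rewrite iter_half_sum.
have -> : \sum_(k < n.+1) 'C(n, k)%:R *: iter k U (f - U f) =
  \sum_(k < n.+1) 'C(n, k)%:R *: iter k U f -
  \sum_(k < n.+1) 'C(n, k)%:R *: iter k.+1 U f.
  rewrite -sumrB; apply: eq_bigr => k _; rewrite -scalerBr; congr (_ *: _).
  elim: (k : nat) => //= j ->; exact: linearB.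
rewrite (sum_bin_difference n (fun k => iter k U f)) normrZ gtr0_norm ?invr_gt0//.
rewrite ler_pdivrMl//.
apply: le_trans (ler_norm_sum _ _ _) _.
apply: (@le_trans _ _ (\sum_(k < n.+2) 'C(n.+1, k)%:R *
    (2^-1 * ((n.+1%:R - 2 * k%:R) ^+ 2 / (n.+1%:R * s) + s / n.+1%:R)) * `|f|)).
  apply: ler_sum => k _; rewrite normrZ; apply: ler_pM => //; last exact: norm_iter.
  rewrite normrM normr_nat ler_wpM2l// normrM (gtr0_norm (x := _^-1)) ?invr_gt0//.
  set x := _ - _; rewrite invfM [n.+1%:R^-1 * _]mulrC mulrA -mulrDl mulrA.
  rewrite ler_pM2r ?invr_gt0// -(ler_pM2r s0) -[x ^+ 2]real_normK ?num_real//.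
  rewrite -mulrA mulrDl divfK ?gt_eqF//.
  have := sqr_ge0 (`|x| - s); rewrite sqrrB; lra.
rewrite -mulr_suml mulrA ler_wpM2r//.
under eq_bigr do rewrite mulrCA mulrDr mulrA.
rewrite -mulr_sumr big_split/= -!mulr_suml sum_bin_variance sum_bin.
rewrite exprS; set N := n.+1%:R; set p := 2 ^+ n.
rewrite le_eqVlt; apply/orP; left; apply/eqP; field.
by rewrite !gt_eqF.
Qed.

End half_sum.

(** * Strong convergence to zero *)

Section vanishing.
Context (R : realType) (V : normedModType R).

Definition vanishing (Q : nat -> V -> V) : set V :=
  [set f | `|Q n f| @[n --> \oo] --> (0 : R)].

Lemma vanishingP Q f : vanishing Q f <->
  forall e : R, 0 < e -> \forall n \near \oo, `|Q n f| <= e.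
Proof.
rewrite /vanishing /=; split.
  by move=> /cvgr0Pnorm_le h e /h; apply: filterS => n; rewrite normr_id.
by move=> h; apply/cvgr0Pnorm_le => e /h; apply: filterS => n; rewrite normr_id.
Qed.

Lemma closed_subspace_vanishing Q :
  (forall n a f g, Q n (a *: f + g) = a *: Q n f + Q n g) ->
  (forall n f, `|Q n f| <= `|f|) -> closed_subspace (vanishing Q).
Proof.
move=> Qlin Qle; split.
- apply/vanishingP => e e0; apply: nearW => n.
  by apply: le_trans (Qle _ _) _; rewrite normr0 ltW.
- move=> a f g /vanishingP Qf /vanishingP Qg; apply/vanishingP => e e0.
  have e20 : 0 < e / 2 by rewrite divr_gt0.
  have a0 : 0 < `|a| + 1 by rewrite ltr_wpDl.
  have := Qf _ (divr_gt0 e20 a0); have := Qg _ e20.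
  apply: filterS2 => n Qgn Qfn; rewrite Qlin.
  apply: le_trans (ler_normD _ _) _; rewrite [leRHS]splitr lerD//.
  rewrite normrZ; apply: (@le_trans _ _ ((`|a| + 1) * `|Q n f|)).
    by rewrite ler_wpM2r// lerDl.
  by rewrite mulrC -ler_pdivlMr.
- move=> f fW; apply/vanishingP => e e0.
  have e20 : 0 < e / 2 by rewrite divr_gt0.
  have [g /vanishingP/(_ _ e20) Qg fg] := fW _ e20.
  apply: filterS Qg => n Qgn.
  have -> : Q n f = Q n (f - g) + Q n g.
    by rewrite -[Q n (f - g)]scale1r -Qlin scale1r subrK.
  apply: le_trans (ler_normD _ _) _; rewrite [leRHS]splitr lerD//.
  exact: le_trans (Qle _ _) fg.
Qed.

Lemma vanishing_half_sum (U : {linear V -> V}) f :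
  (forall f, `|U f| <= `|f|) -> vanishing (fun n => iter n (half_sum U)) (f - U f).
Proof.
move=> Ule; apply/vanishingP => e e0.
pose M := `|f| + 1; have M0 : 0 < M by rewrite ltr_wpDl.
pose s := 2 * M / e; have s0 : 0 < s by rewrite divr_gt0// mulr_gt0.
have : \forall n \near \oo, 2 * s * M / e < n%:R by exact: nbhs_infty_gtr.
apply: filterS => n ns.
apply: le_trans (norm_iter_half_sum Ule n f s0) _.
have n0 : 0 < n.+1%:R :> R by rewrite ltr0n.
have h1 : s^-1 = e / (2 * M) by rewrite /s invf_div.
have h2 : s / n.+1%:R <= e / (2 * M).
  rewrite ler_pdivrMr// mulrAC ler_pdivlMr ?mulr_gt0//.
  have : 2 * s * M <= e * n.+1%:R.
    rewrite -ler_pdivrMl// mulrC ltW// (lt_trans ns)//.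
    by rewrite ltr_nat.
  lra.
apply: (@le_trans _ _ (e / M * `|f|)).
  rewrite ler_wpM2r// h1; apply: le_trans (lerD (lexx _) h2) _.
  by rewrite le_eqVlt; apply/orP; left; apply/eqP; field; rewrite gt_eqF.
by rewrite mulrAC ler_pdivrMr// ler_wpM2l ?(ltW e0)// /M lerDl.
Qed.

End vanishing.

(** * Cesaro means *)

Section markov_operator.
Context d (T : measurableType d) (R : realType) (mu : {measure set T -> \bar R}).
Local Notation V := (L1 mu).
Context (P : V -> V).
Hypothesis Plin : forall a (f g : V), P (a *: f + g) = a *: P f + P g.
Hypothesis Ple : forall f : V, `|P f| <= `|f|.

Local Notation cesaro_mean := (Defs.cesaro P).

Lemma iter_lin n a (f g : V) : iter n P (a *: f + g) = a *: iter n P f + iter n P g.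
Proof. by elim: n => //= n ->; rewrite Plin. Qed.

Lemma iter_le n (f : V) : `|iter n P f| <= `|f|.
Proof. by elim: n => //= n IH; apply: le_trans (Ple _) IH. Qed.

Lemma iterB n (f g : V) : iter n P (f - g) = iter n P f - iter n P g.
Proof. by rewrite -scaleN1r addrC iter_lin scaleN1r addrC. Qed.

Lemma cesaro_mean_lin n a (f g : V) :
  cesaro_mean n (a *: f + g) = a *: cesaro_mean n f + cesaro_mean n g.
Proof.
rewrite /Defs.cesaro scalerA mulrC -scalerA -scalerDr; congr (_ *: _).
by rewrite scaler_sumr -big_split; apply: eq_bigr => i _; exact: iter_lin.
Qed.

Lemma norm_cesaro_mean n (f : V) : `|cesaro_mean n f| <= n%:R^-1 * \sum_(i < n) `|iter i P f|.
Proof.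
by rewrite /Defs.cesaro normrZ ger0_norm ?invr_ge0// ler_wpM2l ?invr_ge0// ler_norm_sum.
Qed.

Lemma cesaro_mean_le n (f : V) : `|cesaro_mean n f| <= `|f|.
Proof.
apply: le_trans (norm_cesaro_mean _ _) _.
case: n => [|n]; first by rewrite big_ord0 mulr0.
rewrite ler_pdivrMl ?ltr0n//.
apply: (@le_trans _ _ (\sum_(i < n.+1) `|f|)).
  by apply: ler_sum => i _; exact: iter_le.
by rewrite sumr_const card_ord mulr_natl.
Qed.

Lemma closed_subspace_vanishing_iter : closed_subspace (vanishing (fun n => iter n P)).
Proof. exact: closed_subspace_vanishing iter_lin iter_le. Qed.

Lemma closed_subspace_vanishing_cesaro : closed_subspace (vanishing cesaro_mean).
Proof. exact: closed_subspace_vanishing cesaro_mean_lin cesaro_mean_le. Qed.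

(** The sum telescopes to [f - P^n f], which is bounded. *)
Lemma vanishing_cesaro_coboundary (f : V) : vanishing cesaro_mean (f - P f).
Proof.
apply/vanishingP => e e0.
have : \forall n \near \oo, 2 * `|f| / e < n%:R by exact: nbhs_infty_gtr.
apply: filterS => n nf.
have n0 : 0 < n%:R :> R by apply: le_lt_trans nf; rewrite divr_ge0 ?mulr_ge0// ltW.
have -> : cesaro_mean n (f - P f) = n%:R^-1 *: (f - iter n P f).
  congr (_ *: _); elim: (n) => [|k IH]; first by rewrite big_ord0 subrr.
  by rewrite big_ord_recr/= IH iterB -iterSr/= addrA subrK.
rewrite normrZ gtr0_norm ?invr_gt0// ler_pdivrMl//.
apply: le_trans (ler_normB _ _) _.
apply: le_trans (lerD (lexx _) (iter_le n f)) _.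
move: nf; rewrite ltr_pdivrMr//; lra.
Qed.

Lemma vanishing_cesaro (f : V) : vanishing (fun n => iter n P) f -> vanishing cesaro_mean f.
Proof.
move=> /cesaro Pf; apply/vanishingP => e e0.
have /cvgr0Pnorm_le/(_ _ e0)[N _ h] := Pf.
exists N.+1 => // -[//|n] /= Nn.
apply: le_trans (norm_cesaro_mean _ _) _.
have := h n Nn; rewrite /arithmetic_mean /= seriesEord/=.
by apply: le_trans; rewrite ler_norm.
Qed.

End markov_operator.

Section L1_convergence.
Context (R : realType).
Local Notation m := (circle_measure R : {measure set (circle R) -> \bar R}).

Lemma dist_to_set1 (f g : L1 m) : dist_to f [set g] = `|f - g|%:E.
Proof. by rewrite /dist_to image_set1 ereal_inf1. Qed.

Lemma density_mean (h : L1 m) : density h -> L1_mean h = L1_one m.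
Proof.
by move=> [h0 h1]; rewrite /L1_mean -ge0_norm_L1// h1 scale1r.
Qed.

(** Strong convergence of [Q n] to the projection onto the constants makes the
    single density 1 attract all densities. *)
Lemma attracted_by_one (Q : nat -> L1 m -> L1 m) :
  (forall n f g, Q n (f - g) = Q n f - Q n g) ->
  (\forall n \near \oo, Q n (L1_one m) = L1_one m) ->
  (forall f : L1 m, vanishing Q (f - L1_mean f)) ->
  forall h, density h -> dist_to (Q n h) [set L1_one m] @[n --> \oo] --> 0%E.
Proof.
move=> QB Q1 Qv h dh.
have /= := Qv h; rewrite density_mean// => Qh.
have : (`|Q n (h - L1_one m)|%:E @[n --> \oo] --> 0%E).
  by apply: cvg_EFin => //; exact: nearW.
apply: cvg_trans; apply: near_eq_cvg.
by apply: filterS Q1 => n Qn1; rewrite dist_to_set1 QB Qn1.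
Qed.

End L1_convergence.

(** * The average of two rotations *)

Section random_rotation.
Context (R : realType) (alpha beta : R).
Local Notation m := (circle_measure R : {measure set (circle R) -> \bar R}).
Implicit Types (f g h : L1 m).

Definition rot_avg f : L1 m := 2^-1 *: rot_op alpha f + 2^-1 *: rot_op beta f.

Local Notation U := (@rot_op R (beta - alpha)).

(** The common rotation is an isometry which commutes with everything in sight, so
    only the powers of [half_sum] remain to be estimated. *)
Lemma rot_avgE f : rot_avg f = rot_op alpha (half_sum U f).
Proof.
by rewrite /half_sum rot_op_add !rot_op_scale rot_opD subrK.
Qed.

Lemma half_sum_rot_op t n f :
  iter n (half_sum U) (rot_op t f) = rot_op t (iter n (half_sum U) f).
Proof.
elim: n => //= n ->; rewrite /half_sum rot_op_add !rot_op_scale.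
by rewrite (rot_opC t).
Qed.

Lemma iter_rot_avg n f : iter n rot_avg f = rot_op (alpha *+ n) (iter n (half_sum U) f).
Proof.
elim: n f => [|n IH] f; first by rewrite mulr0n rot_op0.
by rewrite iterSr IH rot_avgE half_sum_rot_op rot_opD -mulrS iterSr.
Qed.

Lemma rot_avg_lin a f g : rot_avg (a *: f + g) = a *: rot_avg f + rot_avg g.
Proof.
rewrite /rot_avg !rot_op_add !rot_op_scale !scalerDr addrACA.
by rewrite !scalerA ![2^-1 * a]mulrC.
Qed.

Lemma rot_avg_le f : `|rot_avg f| <= `|f|.
Proof.
apply: le_trans (ler_normD _ _) _; rewrite !normrZ !rot_op_norm.
by rewrite gtr0_norm ?invr_gt0// -mulrDl halves mul1r.
Qed.

Lemma rot_avg_one : rot_avg (L1_one m) = L1_one m.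
Proof.
by rewrite /rot_avg !rot_op_one -scalerDl halves scale1r.
Qed.

Lemma iter_rot_avg_one n : iter n rot_avg (L1_one m) = L1_one m.
Proof. by elim: n => //= n ->; exact: rot_avg_one. Qed.

Lemma vanishing_rot_avg f : vanishing (fun n => iter n rot_avg) (f - U f).
Proof.
have Ule g : `|U g| <= `|g| by rewrite rot_op_norm.
apply: cvg_trans (vanishing_half_sum f Ule); apply: near_eq_cvg.
by apply: nearW => n; rewrite iter_rot_avg rot_op_norm.
Qed.

End random_rotation.

Section constrictive_cases.
Context (R : realType) (alpha beta : R).
Local Notation m := (circle_measure R : {measure set (circle R) -> \bar R}).
Implicit Types (f g h : L1 m).
Local Notation U := (@rot_op R (beta - alpha)).
Local Notation P := (rot_avg alpha beta).

Lemma irrationalN (x : R) : irrational x -> irrational (- x).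
Proof.
move=> xi /rationalP[a [b ab]]; apply: xi; apply/rationalP.
by exists (- a), b; rewrite intrN mulNr -ab opprK.
Qed.

Lemma rational_frac (x : R) : rational x ->
  exists (a : int) (q : nat), (0 < q)%N /\ x = a%:~R / q%:R.
Proof.
move=> /rationalP[a [[|q] ->]]; first by exists 0, 1%N; rewrite invr0 mulr0 mul0r.
by exists a, q.+1.
Qed.

Lemma iter_rot_avgB n (f g : L1 m) : iter n P (f - g) = iter n P f - iter n P g.
Proof. exact: (iterB (@rot_avg_lin _ alpha beta)). Qed.

Lemma constrictive_rot_avg : irrational (alpha - beta) -> constrictive P.
Proof.
move=> /irrationalN; rewrite opprB => irr.
exists [set L1_one m]; split; first exact: compact_set1.
apply: (attracted_by_one (Q := fun n => iter n P)).
- exact: iter_rot_avgB.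
- by apply: nearW => n; exact: iter_rot_avg_one.
- apply: (mean_ergodic irr) => [|f]; last exact: vanishing_rot_avg.
  by apply: closed_subspace_vanishing_iter; [exact: rot_avg_lin|exact: rot_avg_le].
Qed.

(** The classes with vanishing Cesaro means contain all [f - T_alpha f]: split [f]
    into [E f], on which [P] acts as [T_alpha], and [f - E f], on which the
    iterates of [P] already tend to 0. *)
Lemma mean_constrictive_rot_avg : irrational alpha -> rational (beta - alpha) ->
  mean_constrictive P.
Proof.
move=> irr /rational_frac[p [q [q0 gamma]]].
have gammaq : (beta - alpha) *+ q \is a Num.int.
  by rewrite gamma -(mulr_natr (p%:~R / q%:R)) divfK ?intr_int// pnatr_eq0 -lt0n.
pose E f := cyclic_avg (beta - alpha) q f.
have clW : closed_subspace (vanishing (Defs.cesaro P)).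
  by apply: closed_subspace_vanishing_cesaro; [exact: rot_avg_lin|exact: rot_avg_le].
have clI : closed_subspace (vanishing (fun n => iter n P)).
  by apply: closed_subspace_vanishing_iter; [exact: rot_avg_lin|exact: rot_avg_le].
have vE f : vanishing (Defs.cesaro P) (f - E f).
  apply: vanishing_cesaro.
  by apply: (coboundary_cyclic_avg f clI _ q0) => g; exact: vanishing_rot_avg.
exists [set L1_one m]; split; first exact: compact_set1.
apply: (attracted_by_one (Q := Defs.cesaro P)).
- move=> n f g; rewrite -scaleN1r addrC cesaro_mean_lin; last exact: rot_avg_lin.
  by rewrite scaleN1r addrC.
- exists 1%N => // n /= n0; rewrite /Defs.cesaro.
  under eq_bigr do rewrite iter_rot_avg_one.
  rewrite sumr_const card_ord -[L1_one m *+ n]scaler_nat scalerA mulVf ?scale1r//.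
  by rewrite pnatr_eq0 -lt0n.
- apply: (mean_ergodic irr) => // f.
  rewrite (_ : _ - _ = (f - E f) - (rot_op alpha f - E (rot_op alpha f)) +
    (E f - P (E f))).
    apply: (closed_subspaceD clW); last first.
      by apply: vanishing_cesaro_coboundary; [exact: rot_avg_lin|exact: rot_avg_le].
    by apply: (closed_subspaceB clW); exact: vE.
  have -> : P (E f) = E (rot_op alpha f).
    rewrite rot_avgE half_sum_fixed; last exact: rot_op_cyclic_avg.
    exact: rot_op_cyclic_avgC.
  by rewrite opprB [f - E f + _]addrC -addrA subrKA addrC subrKA.
Qed.

End constrictive_cases.

(** * Densities concentrated on combs *)

Section concentrated_densities.
Context (R : realType).
Local Notation m := (circle_measure R : {measure set (circle R) -> \bar R}).
Implicit Types (f g h : L1 m) (gamma c s : R).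

(** The uniform density on [q] arcs of length [c] with spacing [gamma], counted
    with multiplicity where they overlap. *)
Definition comb gamma (q : nat) c : L1 m := cyclic_avg gamma q (c^-1 *: arc_class c).

Definition comb_teeth gamma (q : nat) c : set (circle R) :=
  \big[setU/set0]_(j < q) (rotation (- (gamma *+ j)) @^-1` circle_arc c).

Lemma measurable_comb_teeth gamma q c : 0 < c <= 1 -> measurable (comb_teeth gamma q c).
Proof.
move=> c01; apply: bigsetU_measurable => j _.
by apply: measurable_preimage_rotation; exact: measurable_arc.
Qed.

Lemma measure_comb_teeth gamma q c : 0 < c <= 1 ->
  (m (comb_teeth gamma q c) <= (q%:R * c)%:E)%E.
Proof.
move=> c01; have marc := measurable_arc c01.
have mj j : measurable (rotation (- (gamma *+ j)) @^-1` circle_arc c).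
  exact: measurable_preimage_rotation.
apply: le_trans (Boole_inequality m (n := q) (fun j _ => mj j)) _.
rewrite (eq_bigr (fun=> c%:E)); last first.
  move=> j _; transitivity (m (circle_arc c)); first exact: circle_measure_rotation.
  by apply: circle_measure_arc; case/andP: c01 => /ltW -> ->.
by rewrite sumEFin sumr_const card_ord mulr_natl.
Qed.

Lemma fine_measure_le (A B : set (circle R)) : measurable A -> measurable B ->
  A `<=` B -> fine (m A) <= fine (m B).
Proof.
move=> mA mB AB; have fin C : measurable C -> m C \is a fin_num.
  by move=> mC; exact: (@fin_num_measure _ _ _ (circle_measure R)).
by apply: fine_le; rewrite ?fin// le_measure ?inE.
Qed.

Lemma set_int_comb_le gamma q c (B : set (circle R)) : 0 < c <= 1 ->
  (0 < q)%N -> measurable B -> set_int B (comb gamma q c) <= fine (m B) / c.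
Proof.
move=> c01 q0 mB; have marc := measurable_arc c01; have /andP[c0 c1] := c01.
rewrite set_intZ// set_int_sum// ler_pdivrMl ?ltr0n// mulr_natl.
rewrite -[X in _ *+ X](card_ord q) -sumr_const; apply: ler_sum => j _.
have mjB := measurable_preimage_rotation (gamma *+ j) mB.
rewrite set_int_rot_op// set_intZ// mulrC ler_pM2r ?invr_gt0//.
rewrite set_int_arc_class//.
have -> : m B = m (rotation (gamma *+ j) @^-1` B).
  by apply/esym; exact: circle_measure_rotation.
by apply: fine_measure_le => //; exact: measurableI.
Qed.

(** Rotating a comb by less than the width [c] of its teeth keeps it inside the
    comb with teeth of width [2 c]. *)
Lemma set_int_comb gamma q c s (B : set (circle R)) : 0 < c -> 2 * c <= 1 ->
  (0 < q)%N -> 0 <= s < c -> measurable B ->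
  comb_teeth gamma q (2 * c) `<=` B -> set_int B (rot_op s (comb gamma q c)) = 1.
Proof.
move=> c0 c1 q0 /andP[s0 sc] mB teethB.
have c01 : 0 < c <= 1 by apply/andP; split; lra.
have marc := measurable_arc c01.
rewrite rot_op_cyclic_avgC set_intZ// set_int_sum//.
rewrite (eq_bigr (fun=> 1)); last first.
  move=> j _; rewrite rot_opD set_int_rot_op//.
  have mjB := measurable_preimage_rotation (s + gamma *+ j) mB.
  rewrite set_intZ// set_int_arc_class// setIidl; last first.
    move=> x; have [y /andP[y0 y1] ->] := circleP x.
    rewrite arc01 ?y0// => yc /=; apply: teethB.
    rewrite /comb_teeth -(bigcup_mkord q
      (fun j => rotation (- (gamma *+ j)) @^-1` circle_arc (2 * c))); exists j => //=.
    rewrite rotationD rotationE addrK arc01; first by lra.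
    by apply/andP; split; lra.
  rewrite [X in fine X](_ : _ = c%:E) ?mulVf ?gt_eqF//.
  by apply: circle_measure_arc; apply/andP; split; lra.
by rewrite sumr_const card_ord mulVf// pnatr_eq0 -lt0n.
Qed.

Lemma ge0_scale (a : R) f : 0 <= a -> (\forall x \ae m, 0 <= f x) ->
  \forall x \ae m, 0 <= (a *: f : L1 m) x.
Proof.
move=> a0 f0; move: f0 (L1_scaleE a f); apply: filterS2 => x fx ->.
exact: mulr_ge0.
Qed.

Lemma density_comb gamma q c : 0 < c -> 2 * c <= 1 -> (0 < q)%N ->
  density (comb gamma q c).
Proof.
move=> c0 c1 q0; have c01 : 0 < c <= 1 by apply/andP; split; lra.
suff h0 : \forall x \ae m, 0 <= comb gamma q c x.
  split => //; rewrite ge0_norm_L1// -(rot_op0 (comb gamma q c)).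
  by apply: set_int_comb; rewrite ?lexx.
apply: ge0_scale; first by rewrite invr_ge0.
elim/big_ind : _ => [|f g f0 g0|j _].
- by rewrite -(scale0r (0 : L1 m)); apply: filterS (L1_scaleE 0 (0 : L1 m)) => x ->;
    rewrite mul0r.
- by move: f0 g0 (L1_addE f g); apply: filterS3 => x f0 g0 ->; exact: addr_ge0.
- apply: rot_op_ge0; apply: ge0_scale; first by rewrite invr_ge0 ltW.
  have iarc := integrable_indic_circle (measurable_arc c01).
  by apply: filterS (L1_ofE iarc) => x ->; rewrite indicE.
Qed.

End concentrated_densities.

Section negative_cases.
Context (R : realType) (alpha beta : R).
Local Notation m := (circle_measure R : {measure set (circle R) -> \bar R}).
Local Notation P := (rot_avg alpha beta).

Lemma iter_rot_avg_fixed n (h : L1 m) : rot_op (beta - alpha) h = h ->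
  iter n P h = rot_op (alpha *+ n) h.
Proof.
move=> Uh; rewrite iter_rot_avg; congr rot_op.
by elim: n => //= n ->; exact: half_sum_fixed.
Qed.

(** A comb invariant under the rotation by [beta - alpha] is moved by [P] as by
    the rotation by [alpha]. By Kronecker's theorem arbitrarily large powers of
    the latter move it by less than one tooth, so that all its mass is again in a
    set of prescribed small measure. *)
Lemma not_asymptotically_constrictive_rot_avg : irrational alpha ->
  rational (beta - alpha) -> ~ asymptotically_constrictive P.
Proof.
move=> irr /rational_frac[p [q [q0 gammaE]]] ac.
have [d d0 acd] := ac 1 ltr01.
set gamma := beta - alpha in gammaE.
have gammaq : gamma *+ q \is a Num.int.
  by rewrite gammaE -(mulr_natr (p%:~R / q%:R)) divfK ?intr_int// pnatr_eq0 -lt0n.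
have qR0 : 0 < q%:R :> R by rewrite ltr0n.
(* q teeth of width 2 c have total measure less than d. *)
pose c := Num.min (2^-1) (d / (4 * q%:R)).
have c0 : 0 < c by rewrite lt_min invr_gt0 ltr0n divr_gt0// mulr_gt0.
have c2 : 2 * c <= 1.
  have : c <= 2^-1 by rewrite ge_min lexx.
  lra.
have qc : q%:R * (2 * c) < d.
  have : c <= d / (4 * q%:R) by rewrite ge_min lexx orbT.
  rewrite ler_pdivlMr ?mulr_gt0//; lra.
have c201 : 0 < 2 * c <= 1 by apply/andP; split; lra.
pose h := comb gamma q c; pose A := comb_teeth gamma q (2 * c).
have mA : measurable A by exact: measurable_comb_teeth.
have := acd h A (density_comb gamma c0 c2 q0) mA.
have /[swap]/[apply] : (m A < d%:E)%E.
  by apply: le_lt_trans (measure_comb_teeth _ _ c201) _; rewrite lte_fin.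
apply/negP; rewrite -leNgt; apply: le_ereal_inf_tmp => _ [B [N _ NB] <-].
have c20 : 0 < c / 2 by rewrite divr_gt0.
(* The target c / 2 is shifted by N alpha so that the index n + N found is at
   least N. *)
have [n [k nk]] := kronecker (c / 2 - N%:R * alpha) irr c20.
pose s := (n + N)%:R * alpha + k%:~R.
have sc : 0 <= s < c.
  move: nk; rewrite ltr_norml => /andP[nk1 nk2].
  by rewrite /s natrD mulrDl; apply/andP; split; lra.
apply: ereal_sup_ubound; exists (n + N)%N; first by apply: NB; exact: leq_addl.
congr EFin.
rewrite -[LHS]/(set_int A (iter (n + N) P h)) iter_rot_avg_fixed; last first.
  exact: rot_op_cyclic_avg.
have -> : rot_op (alpha *+ (n + N)) h = rot_op s h.
  by rewrite /s -rot_opD rot_op_int mulr_natl.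
exact: set_int_comb.
Qed.

(** The doubled teeth of the thin comb carry all the mass of the thin comb, and at
    most half of that of the wide one, whose values are bounded by [1/c]. *)
Lemma norm_comb_sub (gamma : R) q (c c' : R) :
  (0 < q)%N -> 0 < c' -> c' <= c / (4 * q%:R) -> c <= 1 ->
  2^-1 <= `|comb gamma q c' - comb gamma q c|.
Proof.
move=> q0 c'0 c'c c1; have qR0 : 0 < q%:R :> R by rewrite ltr0n.
have qR1 : 1 <= q%:R :> R by rewrite ler1n.
have c'c2 : c' * (4 * q%:R) <= c by rewrite -ler_pdivlMr ?mulr_gt0.
have c'c4 : c' * 4 <= c.
  by apply: le_trans c'c2; rewrite ler_pM2l//; lra.
have c201 : 0 < 2 * c' <= 1 by apply/andP; split; lra.
have c01 : 0 < c <= 1 by apply/andP; split; lra.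
pose A := comb_teeth gamma q (2 * c').
have mA : measurable A by exact: measurable_comb_teeth.
apply: le_trans (le_norm_set_int _ mA); apply: le_trans (ler_norm _).
rewrite set_intB// -{1}(rot_op0 (comb gamma q c')) set_int_comb ?lexx//; last by lra.
have : set_int A (comb gamma q c) <= 2^-1.
  apply: le_trans (set_int_comb_le gamma c01 q0 mA) _.
  have fA : fine (m A) <= q%:R * (2 * c').
    rewrite -[leRHS]/(fine (q%:R * (2 * c'))%:E); apply: fine_le => //.
      exact: (@fin_num_measure _ _ _ (circle_measure R)).
    exact: measure_comb_teeth.
  rewrite ler_pdivrMr; last by case/andP: c01.
  by apply: le_trans fA _; lra.
lra.
Qed.

End negative_cases.

(** * Weak compactness of orbits for rational angles *)

Section weak_topology.
Context (R : realType) (V : normedModType R).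
Local Notation dual := {f : {linear V -> R^o} | continuous f}.

Lemma weakly_functional_continuous (f : dual) :
  continuous (sval f : weakly V -> R^o).
Proof.
move=> p; have FF : Filter (nbhs (p : weakly V)) by exact: nbhs_filter.
have pp : (nbhs (p : weakly V)) --> (p : weakly V) by exact: cvg_id.
have /= h := (cvg_sup _ _ FF).1 pp f.
move=> A /(@initial_continuous _ _ (sval f) p) fA.
exact: h fA.
Qed.

Lemma weakly_norm_continuous : continuous (id : V -> weakly V).
Proof.
move=> p; apply/(cvg_sup (T := V)) => f A /= [_ [[C oC <-] Cp] CA].
have fp : sval f x @[x --> p] --> sval f p by exact: (svalP f).
have fC : nbhs p (sval f @^-1` C) by apply: fp; exact: open_nbhs_nbhs.
by apply: filterS fC => x; exact: CA.
Qed.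

Lemma weakly_hausdorff :
  (forall p q : V, (forall f : dual, sval f p = sval f q) -> p = q) ->
  hausdorff_space (weakly V).
Proof.
move=> sep p q clpq; apply: sep => f; apply: (@Rhausdorff R) => A B fA fB.
have nA : nbhs (p : weakly V) (sval f @^-1` A).
  by have /(_ A fA) := @weakly_functional_continuous f p.
have nB : nbhs (q : weakly V) (sval f @^-1` B).
  by have /(_ B fB) := @weakly_functional_continuous f q.
by have [r [Ar Br]] := clpq _ _ nA nB; exists (sval f r).
Qed.

(** A norm compact set is weakly compact; it is also weakly closed, as precompactness
    requires, because the functionals separate points. *)
Lemma precompact_weakly (K A : set V) :
  (forall p q : V, (forall f : dual, sval f p = sval f q) -> p = q) ->
  compact K -> A `<=` K -> precompact (A : set (weakly V)).
Proof.
move=> sep cK AK; have cwK : compact (K : set (weakly V)).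
  have -> : (K : set (weakly V)) = (id : V -> weakly V) @` K.
    by rewrite image_id.
  apply: continuous_compact => //; apply: continuous_subspaceT => p.
  exact: weakly_norm_continuous.
apply: (@precompact_subset (weakly V) A K) => //.
rewrite precompact_closed//; apply: compact_closed => //.
exact: weakly_hausdorff.
Qed.

(** All combinations of [s] with coefficients in [0, 1]. The recursion exhibits the
    set as a continuous image of a product with the interval, which gives
    compactness at once. *)
Definition cube_span (s : seq V) : set V :=
  foldr (fun v K => [set cw.1 *: v + cw.2 | cw in [set` `[0%R, 1%R]] `*` K]) [set 0] s.

Lemma compact_cube_span s : compact (cube_span s).
Proof.
elim: s => [|v s IH] /=; first exact: compact_set1.
apply: continuous_compact; last by apply: compact_setX => //; exact: segment_compact.
apply: continuous_subspaceT => -[c w] /=.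
apply: cvgD; last exact: cvg_snd.
by apply: cvgZr_tmp; exact: cvg_fst.
Qed.

Lemma cube_span_sum I (s : seq I) (v : I -> V) (c : I -> R) :
  (forall i, 0 <= c i <= 1) -> cube_span [seq v i | i <- s] (\sum_(i <- s) c i *: v i).
Proof.
move=> c01; elim: s => [|i s IH] /=; first by rewrite big_nil.
rewrite big_cons; exists (c i, \sum_(i <- s) c i *: v i) => //.
by split => //=; rewrite in_itv/=.
Qed.

End weak_topology.

Section rational_case.
Context (R : realType) (alpha beta : R).
Local Notation m := (circle_measure R : {measure set (circle R) -> \bar R}).
Implicit Types (f g h : L1 m).
Local Notation P := (rot_avg alpha beta).

Lemma L1_functionals_separate (p q : L1 m) :
  (forall f : {f : {linear L1 m -> R^o} | continuous f}, sval f p = sval f q) -> p = q.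
Proof.
move=> sep; apply: L1_set_int_inj => A mA.
have lin : linear (set_int A : L1 m -> R^o).
  by move=> a f g; rewrite set_intD// set_intZ.
pose F : {linear L1 m -> R^o} := HB.pack (set_int A : L1 m -> R^o)
  (GRing.isLinear.Build R (L1 m) R^o _ (set_int A : L1 m -> R^o) lin).
have cF : continuous F.
  move=> f; have FF : Filter (nbhs f) := nbhs_filter f.
  apply/(@cvgrPdist_le R R^o (L1 m) (nbhs f) FF) => e e0.
  have nb : nbhs f (ball f e) by exact: nbhsx_ballx.
  apply: filterS nb => g; rewrite -ball_normE /= => /ltW; apply: le_trans.
  by rewrite -[X in `|X|]/(set_int A f - set_int A g) -set_intB// le_norm_set_int.
exact: (sep (exist _ F cF)).
Qed.

(** The convex hull of the first [q] rotates of [f]. *)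
Definition rot_hull (gamma : R) (q : nat) f : set (L1 m) :=
  [set g | exists c : 'I_q -> R, [/\ forall i, 0 <= c i, \sum_i c i = 1 &
    g = \sum_i c i *: rot_op (gamma *+ i) f]].

Lemma rot_hull_half_sum gamma q f g h : rot_hull gamma q f g -> rot_hull gamma q f h ->
  rot_hull gamma q f (2^-1 *: g + 2^-1 *: h).
Proof.
move=> [c [c0 c1 ->]] [d [d0 d1 ->]]; exists (fun i => 2^-1 * c i + 2^-1 * d i); split.
- by move=> i; rewrite addr_ge0// mulr_ge0 ?invr_ge0.
- by rewrite big_split/= -!mulr_sumr c1 d1; field.
- rewrite !scaler_sumr -big_split; apply: eq_bigr => i _.
  by rewrite scalerDl !scalerA.
Qed.

(** The rotation by [gamma] permutes the rotates of [f] cyclically. *)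
Lemma rot_hull_rot gamma q f g : gamma *+ q \is a Num.int ->
  rot_hull gamma q f g -> rot_hull gamma q f (rot_op gamma g).
Proof.
move=> /intrP[k gq] [c [c0 c1 ->]].
exists (fun i => c (ord_pred i)); split => //.
  by rewrite (reindex _ (onW_bij _ (ord_pred_bij q))) in c1.
rewrite rot_op_sum [RHS](reindex _ (onW_bij _ (ordS_bij q))).
apply: eq_bigr => i _; rewrite ordSK rot_op_scale.
suff -> : rot_op gamma (rot_op (gamma *+ i) f) = rot_op (gamma *+ (ordS i)) f by [].
rewrite rot_opD -mulrSr /=.
have [iq|qi] := ltnP i.+1 q; first by rewrite modn_small.
have -> : i.+1 = q by apply/eqP; rewrite eqn_leq qi ltn_ord.
by rewrite modnn gq rot_op_int rot_op0.
Qed.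

Lemma common_denominator : 0 <= alpha -> 0 <= beta -> rational alpha -> rational beta ->
  exists q a b : nat, [/\ (0 < q)%N, alpha = q%:R^-1 *+ a & beta = q%:R^-1 *+ b].
Proof.
have pos (x : R) : 0 <= x -> rational x -> exists q a : nat, (0 < q)%N /\ x = a%:R / q%:R.
  move=> x0 /rational_frac[a [q [q0 xE]]]; exists q; move: x0; rewrite xE.
  rewrite pmulr_lge0 ?invr_gt0 ?ltr0n// ler0z; case: a xE => // a xE _.
  by exists a.
move=> a0 b0 /(pos _ a0)[q [a [q0 ->]]] /(pos _ b0)[q' [b [q'0 ->]]].
have qn0 : q%:R != 0 :> R by rewrite pnatr_eq0 -lt0n.
have q'n0 : q'%:R != 0 :> R by rewrite pnatr_eq0 -lt0n.
exists (q * q')%N, (a * q')%N, (b * q)%N; split; first by rewrite muln_gt0 q0.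
- by rewrite -(mulr_natr _ (a * q')) !natrM; field; rewrite ?qn0 ?q'n0.
- by rewrite -(mulr_natr _ (b * q)) !natrM; field; rewrite ?qn0 ?q'n0.
Qed.

Lemma weakly_almost_periodic_rot_avg : 0 <= alpha -> 0 <= beta ->
  rational alpha -> rational beta -> weakly_almost_periodic P.
Proof.
move=> a0 b0 ra rb f; have [q [a [b [q0 aE bE]]]] := common_denominator a0 b0 ra rb.
set gamma := q%:R^-1 in aE bE.
have gq : gamma *+ q \is a Num.int.
  by rewrite -(mulr_natr gamma) /gamma mulVf ?rpred1// pnatr_eq0 -lt0n.
have hullM k g : rot_hull gamma q f g -> rot_hull gamma q f (rot_op (gamma *+ k) g).
  move=> fg; rewrite -iter_rot; elim: k => //= k IH.
  exact: rot_hull_rot.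
have hull n : rot_hull gamma q f (iter n P f).
  elim: n => [|n IH] /=.
    exists (fun i : 'I_q => (i == Ordinal q0)%:R); split => //.
      by rewrite (bigD1 (Ordinal q0))//= big1 ?addr0 ?eqxx// => i /negbTE ->.
    rewrite (bigD1 (Ordinal q0))//= ?eqxx scale1r mulr0n rot_op0 big1 ?addr0// => i.
    by move=> /negbTE ->; rewrite scale0r.
  have := hullM b _ IH; have := hullM a _ IH; rewrite -aE -bE.
  exact: rot_hull_half_sum.
pose K := cube_span [seq rot_op (gamma *+ (i : 'I_q)) f | i <- index_enum 'I_q].
have PK : [set iter n P f | n in [set n | (1 <= n)%N]] `<=` K.
  move=> _ [n _ <-]; have [c [c0 c1 ->]] := hull n.
  apply: cube_span_sum => i; rewrite c0/= -c1 (bigD1 i)//= lerDl.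
  by apply: sumr_ge0.
have cK : compact K by exact: compact_cube_span.
exact: precompact_weakly L1_functionals_separate cK PK.
Qed.

End rational_case.

(** * Failure of mean constrictivity for rational angles *)

Section not_mean_constrictive.
Context (R : realType) (alpha beta : R).
Local Notation m := (circle_measure R : {measure set (circle R) -> \bar R}).
Local Notation P := (rot_avg alpha beta).

Lemma separated_not_compact (V : normedModType R) (K : set V) (psi : nat -> V) (e : R) :
  0 < e -> (forall k, K (psi k)) ->
  (forall k l, (k < l)%N -> e <= `|psi l - psi k|) -> ~ compact K.
Proof.
move=> e0 Kpsi sep cK.
have [|p [_ clp]] := cK (psi @ \oo) _; first by exists 0%N => // k _; exact: Kpsi.
have e20 : 0 < e / 2 by rewrite divr_gt0.
have near_p N : exists2 k, (N <= k)%N & `|p - psi k| < e / 2.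
  have tailN : (psi @ \oo) [set psi k | k in [set k | (N <= k)%N]].
    by exists N => // k /= Nk; exists k.
  have [_ [[k Nk <-]]] := clp _ _ tailN (nbhsx_ballx p _ e20).
  by rewrite -ball_normE /= => pk; exists k.
have [k _ pk] := near_p 0%N; have [l kl pl] := near_p k.+1.
have := sep _ _ kl; apply/negP; rewrite -ltNge.
rewrite (_ : _ - _ = (p - psi k) - (p - psi l)); last first.
  by rewrite opprB [RHS]addrC addrA subrK.
by apply: le_lt_trans (ler_normB _ _) _; rewrite [ltRHS]splitr ltrD.
Qed.

Lemma separated_approximations (V : normedModType R) (h h' u u' : V) :
  2^-1 <= `|h' - h| -> `|h - u| < 8^-1 -> `|h' - u'| < 8^-1 -> 4^-1 <= `|u' - u|.
Proof.
have := ler_distD u' h' h; have := ler_distD u u' h; rewrite (distrC u h).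
lra.
Qed.

(** The combs with spacing 1/q are fixed by [P], so a compact attractor would have
    to come arbitrarily close to each of them. *)
Lemma not_mean_constrictive_rot_avg : 0 <= alpha -> 0 <= beta ->
  rational alpha -> rational beta -> ~ mean_constrictive P.
Proof.
move=> a0 b0 ra rb [F [cF dF]].
have [q [a [b [q0 aE bE]]]] := common_denominator a0 b0 ra rb.
set gamma := q%:R^-1 in aE bE.
have gq : gamma *+ q \is a Num.int.
  by rewrite -(mulr_natr gamma) /gamma mulVf ?rpred1// pnatr_eq0 -lt0n.
have qR1 : 1 <= q%:R :> R by rewrite ler1n.
have r0 : 0 < (4 * q%:R)^-1 :> R by rewrite invr_gt0; lra.
have r1 : (4 * q%:R)^-1 <= 4^-1 :> R.
  by rewrite lef_pV2 ?posrE//; lra.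
(* Consecutive widths have the ratio which makes the combs 1/2-separated. *)
pose c k : R := (4 * q%:R)^-1 ^+ k.+1.
have c0 k : 0 < c k by exact: exprn_gt0.
have cle k l : (k <= l)%N -> c l <= c k.
  by move=> kl; rewrite ler_wiXn2l ?ltnS//; lra.
have c1 k : c k <= 4^-1 by apply: le_trans (cle 0%N k _) _; rewrite // /c expr1.
have c2 k : 2 * c k <= 1 by have := c1 k; lra.
pose h k := comb gamma q (c k).
have Ph k : P (h k) = h k.
  have fixM n : rot_op (gamma *+ n) (h k) = h k.
    rewrite -iter_rot; elim: n => //= n ->.
    exact: rot_op_cyclic_avg.
  by rewrite /rot_avg aE bE !fixM -scalerDl halves scale1r.
have Fh k : exists2 psi, F psi & `|h k - psi| < 8^-1.
  have /(_ _ (open_ereal_lt' _)) near0 := dF _ (density_comb gamma (c0 k) (c2 k) q0).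
  have e0 : (0 < (8^-1 : R)%:E)%E by rewrite lte_fin.
  have [N _ /(_ N.+1 (leqnSn N))] := near0 _ e0.
  rewrite /= [X in dist_to X _](_ : _ = h k); last first.
    rewrite /Defs.cesaro (eq_bigr (fun=> h k)); last first.
      by move=> i _; elim: (i : nat) => //= j ->.
    rewrite sumr_const card_ord -[h k *+ _]scaler_nat scalerA.
    by rewrite mulVf ?scale1r// pnatr_eq0.
  by move=> /ereal_inf_lt[_ [psi Fpsi <-]]; rewrite lte_fin; exists psi.
pose psi k := sval (cid2 (Fh k)).
have Fpsi k : F (psi k) by rewrite /psi; case: cid2.
have hpsi k : `|h k - psi k| < 8^-1 by rewrite /psi; case: cid2.
apply: (@separated_not_compact _ F psi 4^-1) => // k l kl.
have hkl : 2^-1 <= `|h l - h k|.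
  apply: norm_comb_sub => //; last by have := c1 k; lra.
  by rewrite mulrC; apply: le_trans (cle _ _ kl) _; rewrite /c exprS.
exact: separated_approximations hkl (hpsi k) (hpsi l).
Qed.

End not_mean_constrictive.

Theorem proposition1p21 (R : realType) (alpha beta : R)
    (halpha : alpha \in `[0, 1]) (hbeta : beta \in `[0, 1]) :
  let m : {measure set (circle R) -> \bar R} := circle_measure R in
  let L_1 : L1 m -> L1 m := perron_frobenius (rotation alpha) in
  let L_2 : L1 m -> L1 m := perron_frobenius (rotation beta) in
  let L_f : L1 m -> L1 m := fun phi => 2^-1 *: L_1 phi + 2^-1 *: L_2 phi in
  [/\ irrational (alpha - beta) -> constrictive L_f,
      irrational alpha -> irrational beta -> rational (alpha - beta) ->
        mean_constrictive L_f /\ ~ asymptotically_constrictive L_f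
    & rational alpha -> rational beta ->
        weakly_almost_periodic L_f /\ ~ mean_constrictive L_f].
Proof.
move=> m L_1 L_2 L_f.
have a0 : 0 <= alpha by move: halpha; rewrite in_itv/= => /andP[].
have b0 : 0 <= beta by move: hbeta; rewrite in_itv/= => /andP[].
split.
- exact: constrictive_rot_avg.
- move=> ia _ rab.
  have rba : rational (beta - alpha).
    move: rab => /rationalP[p [q pq]]; apply/rationalP.
    by exists (- p), q; rewrite intrN mulNr -pq opprB.
  split; first exact: mean_constrictive_rot_avg.
  exact: not_asymptotically_constrictive_rot_avg.
- move=> ra rb; split; first exact: weakly_almost_periodic_rot_avg.
  exact: not_mean_constrictive_rot_avg.
Qed.
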